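(* There exists a unitary operator on a separable complex Hilbert space which is weakly supercyclic and not weakly sequentially supercyclic.
   Context: Let $T$ be a bounded linear operator on a complex Banach space $\mathcal{B}$; for $x\in\mathcal{B}$ put $O_{\rm pr}(T,x)=\{\lambda T^nx:n=0,1,2,\dots,\ \lambda\in\mathbb{C}\}$. $T$ is weakly supercyclic if $O_{\rm pr}(T,x)$ is weakly dense in $\mathcal{B}$ for some $x$. A subset $A$ of a topological space $X$ is sequentially closed if the limit of every sequence of elements of $A$ converging in $X$ belongs to $A$; the sequential closure $[A]_{\rm s}$ is the intersection of all sequentially closed sets containing $A$; $A$ is sequentially dense if $[A]_{\rm s}=X$. $T$ is weakly sequentially supercyclic if for some $x$ the set $O_{\rm pr}(T,x)$ is sequentially dense in $\mathcal{B}$ with the weak topology. *)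

(* Defs.v *)
From HB Require Import structures.
From mathcomp Require Import all_boot all_order all_algebra.
From mathcomp Require Import all_classical all_reals all_analysis.
From mathcomp Require Export complex.

Set Implicit Arguments.
Unset Strict Implicit.
Unset Printing Implicit Defensive.

Import Order.TTheory GRing.Theory Num.Theory.
Import numFieldNormedType.Exports.

Local Open Scope classical_set_scope.
Local Open Scope ring_scope.

Section SequentialClosure.
Variable X : topologicalType.

Definition separable := exists2 D : set X, countable D & dense D.

Definition seq_closed (A : set X) :=
  forall (u : nat -> X) (l : X),
    (forall n, A (u n)) -> u n @[n --> \oo] --> l -> A l.

Definition seq_closure (A : set X) : set X := smallest seq_closed A.

Definition seq_dense (A : set X) := seq_closure A = [set: X].

End SequentialClosure.

Section WeakTopology.
Variables (K : numFieldType) (V : normedModType K).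

Definition dual := {f : {scalar V} | continuous (f : V -> K^o)}.

Definition weak_topology : topologicalType :=
  sup_topology (fun f : dual =>
    Topological.class (initial_topology (sval f : V -> K^o))).

Variable T : V -> V.

Definition proj_orbit (x : V) : set V :=
  [set y | exists (n : nat) (lambda : K), y = lambda *: iter n T x].

Definition weakly_supercyclic :=
  exists x : V, @dense weak_topology (proj_orbit x).

Definition weakly_sequentially_supercyclic :=
  exists x : V, @seq_dense weak_topology (proj_orbit x).

End WeakTopology.

Section Hilbert.
Variables (C : numClosedFieldType) (H : normedModType C).
Variable ip : {dot H for Num.conj}.

Definition induces_norm := forall x : H, `|x| = sqrtC (ip x x).

(* S is the adjoint of T, so the last two conditions read T^* T = T T^* = 1. *)
Definition unitary (T : {linear H -> H}) :=
  continuous T /\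
  exists S : {linear H -> H},
    [/\ forall x y, ip (T x) y = ip x (S y), cancel T S & cancel S T].

End Hilbert.

(* Main.v *)
Require Import Defs.
From HB Require Import structures.
From mathcomp Require Import all_boot all_order all_algebra.
From mathcomp Require Import all_classical all_reals all_analysis.
From mathcomp Require Import ring lra zify.
Import Order.TTheory GRing.Theory Num.Theory.
Import numFieldNormedType.Exports.

(** The operator is multiplication by [z] on [L^2(mu)], where [mu] is the Riesz
    product of the factors [1 + 2 e_k Re (conj p_k z^N_k)] on the unit circle;
    the [p_k] run through a dense set of polynomials, each taken infinitely
    often, and the frequencies [N_k] are very lacunary.

    It is not weakly sequentially supercyclic because [e_k |p_k|_1] tends to 0,
    so that the Fourier coefficients of [mu] vanish at infinity
    ([riesz_corr_null]) and [T^m] tends weakly to 0.  Suppose that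
    [c_k T^m_k x] converges weakly to [l].  Either some exponent recurs, and [l]
    lies on the line of the corresponding [T^m x], or [m_k] tends to infinity.
    In the second case the [c_k] are bounded, because weakly convergent
    sequences are bounded ([weakly_bounded_bounded]), and therefore [l = 0].  So
    projective orbits are weakly sequentially closed ([weak_limit_proj_orbit]),
    while countably many lines never fill the space ([proj_orbit_neqT]).

    It is weakly supercyclic because the topological closure allows unbounded
    scalars.  When [N_k] is large compared with the degrees used so far, the
    residual [z^N_k - e_k p_k] is orthogonal in [L^2(mu)] to all polynomials of
    low degree, in particular to the earlier residuals ([resid_orthogonal]).
    Along the indices [k] at which [p_k] is a given [p], the vectors
    [e_k^-1 T^N_k 1] are [p] plus errors which are orthogonal and of norm at most
    [2 / e_k]; if the sum of the [e_k ^ 2] diverges along these indices, Bessel's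
    inequality forces some of the errors to be small on any finite set of
    functionals ([weakly_dense_orbit]).  Both requirements hold if the
    index of [p_k] is the 2-adic valuation of [k + 1] and [e_k] is
    [(k + 1)^(-1/2)] times a suitable constant depending on [p_k]
    ([riesz_poly], [riesz_amp]).

    The measure enters through its Gram form [rlim] on polynomials.  This form
    is obtained by letting the factors act one by one on forms:
    a factor preserves positivity by Cauchy-Schwarz ([riesz_step_psd]) and, by
    lacunarity, does not alter the form in low degrees ([rform_stable]).  The
    Hilbert space is the completion of [{poly R[i]}] for this form
    ([gns_hilbert]).  This space only sees nonnegative powers of [z], but
    multiplication by [z] is still onto: the residuals with [p = 1] show that
    [1] is a limit of multiples of [z] ([one_approx]). *)

Set Implicit Arguments.
Unset Strict Implicit.
Unset Printing Implicit Defensive.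
Local Open Scope complex_scope.
Local Open Scope ring_scope.

(** * Moduli of complex numbers *)
Section ComplexModulus.
Variable R : realType.
Implicit Types (x y : R) (z w : R[i]).

(** The norm of [R[i]] has values in [R[i]], whose order is only partial;
    estimates are carried out with this real-valued copy. *)
Definition cabs z : R := complex.Re `|z|.

Lemma normr_cabs z : `|z| = (cabs z)%:C.
Proof. by rewrite /cabs RRe_real// normr_real. Qed.

Lemma cabs_ge0 z : 0 <= cabs z.
Proof. by rewrite -lecR -normr_cabs normr_ge0. Qed.

Lemma cabs0 : cabs 0 = 0.
Proof. by rewrite /cabs normr0. Qed.

Lemma cabs1 : cabs 1 = 1.
Proof. by rewrite /cabs normr1. Qed.

Lemma cabs_eq0 z : (cabs z == 0) = (z == 0).
Proof. by rewrite -(inj_eq (@complexI R)) -normr_cabs normr_eq0. Qed.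

Lemma cabsM z w : cabs (z * w) = cabs z * cabs w.
Proof. by apply: (@complexI R); rewrite rmorphM -!normr_cabs normrM. Qed.

Lemma cabsN z : cabs (- z) = cabs z.
Proof. by rewrite /cabs normrN. Qed.

Lemma cabsV z : cabs z^-1 = (cabs z)^-1.
Proof. by apply: (@complexI R); rewrite fmorphV -!normr_cabs normfV. Qed.

Lemma cabsB z w : cabs (z - w) = cabs (w - z).
Proof. by rewrite /cabs distrC. Qed.

Lemma cabsD z w : cabs (z + w) <= cabs z + cabs w.
Proof. by rewrite -lecR rmorphD/= -!normr_cabs ler_normD. Qed.

Lemma cabs_real x : cabs x%:C = `|x|.
Proof. by rewrite /cabs normc_def /= expr0n addr0 sqrtr_sqr. Qed.

Lemma cabs_nat m : cabs m%:R = m%:R.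
Proof. by rewrite -(rmorph_nat (real_complex R)) cabs_real normr_nat. Qed.

Lemma conj_real x : (x%:C)^* = x%:C :> R[i].
Proof. exact: conjc_real. Qed.

Lemma cabs_conj z : cabs z^* = cabs z.
Proof. by rewrite /cabs norm_conjC. Qed.

Lemma cabs_Re z : `|complex.Re z| <= cabs z.
Proof. by rewrite -lecR -normr_cabs normc_ge_Re. Qed.

Lemma cabs_Im z : `|complex.Im z| <= cabs z.
Proof.
rewrite -lecR -normr_cabs -(normrN (complex.Im z)) -ReiNIm.
by rewrite (le_trans (normc_ge_Re _))// normrM complexiE normCi mulr1.
Qed.

Lemma cabs_ReIm z : cabs z <= `|complex.Re z| + `|complex.Im z|.
Proof.
rewrite -lecR -normr_cabs [z in leLHS]complexE (le_trans (ler_normD _ _))//.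
by rewrite normrM complexiE normCi mul1r rmorphD !normr_cabs !cabs_real.
Qed.

Lemma mul_conj z : z * z^* = (cabs z ^+ 2)%:C.
Proof. by rewrite -normCK normr_cabs rmorphXn. Qed.

Lemma cabs_small_eq0 z (c : R) : (forall e : R, 0 < e -> cabs z <= c * e) -> z = 0.
Proof.
move=> h; apply/eqP; rewrite -cabs_eq0 eq_le cabs_ge0 andbT.
rewrite leNgt; apply/negP => z0.
have c0 : 0 <= c by have := h 1 ltr01; have := cabs_ge0 z; lra.
have e0 : 0 < cabs z / (2 * (c + 1)) by rewrite divr_gt0// mulr_gt0//; lra.
have := h _ e0; rewrite mulrCA ler_pMr// ler_pdivlMr ?mul1r; lra.
Qed.

End ComplexModulus.

(** * Positive semidefinite hermitian forms *)
Section PsdForms.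
Variables (R : realType) (V : lmodType R[i]).

(** Null vectors are allowed: the forms on polynomials are only shown to be
    semidefinite, and the completion divides the null vectors out. *)
Record psd_form (B : V -> V -> R[i]) : Prop := PsdForm {
  psd_linear : forall a f g h, B (a *: f + g) h = a * B f h + B g h;
  psd_herm : forall f g, B g f = (B f g)^*;
  psd_ge0 : forall f, 0 <= B f f }.

(** The seminorm of a positive semidefinite form. *)
Definition sn (B : V -> V -> R[i]) (f : V) : R := Num.sqrt (complex.Re (B f f)).

Lemma sn_ge0 B f : 0 <= sn B f.
Proof. exact: sqrtr_ge0. Qed.

Section Theory.
Variable B : V -> V -> R[i].
Hypothesis hB : psd_form B.
Local Notation n := (sn B).

Lemma psdDl f g h : B (f + g) h = B f h + B g h.
Proof. by rewrite -[f in LHS]scale1r (psd_linear hB) mul1r. Qed.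

Lemma psd0l h : B 0 h = 0.
Proof. by apply: (addIr (B 0 h)); rewrite -psdDl !add0r. Qed.

Lemma psdZl a f h : B (a *: f) h = a * B f h.
Proof. by rewrite -[a *: f]addr0 (psd_linear hB) psd0l addr0. Qed.

Lemma psdNl f h : B (- f) h = - B f h.
Proof. by rewrite -scaleN1r psdZl mulN1r. Qed.

Lemma psdBl f g h : B (f - g) h = B f h - B g h.
Proof. by rewrite psdDl psdNl. Qed.

Lemma psdDr f g h : B h (f + g) = B h f + B h g.
Proof. by rewrite (psd_herm hB) psdDl rmorphD/= -!(psd_herm hB). Qed.

Lemma psdZr a f h : B h (a *: f) = a^* * B h f.
Proof. by rewrite (psd_herm hB) psdZl rmorphM/= -!(psd_herm hB). Qed.

Lemma psdNr f h : B h (- f) = - B h f.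
Proof. by rewrite (psd_herm hB) psdNl rmorphN/= -!(psd_herm hB). Qed.

Lemma psdBr f g h : B h (f - g) = B h f - B h g.
Proof. by rewrite psdDr psdNr. Qed.

Lemma psd0r h : B h 0 = 0.
Proof. by rewrite (psd_herm hB) psd0l rmorph0. Qed.

Lemma psd_suml I (s : seq I) (P : pred I) (F : I -> V) h :
  B (\sum_(i <- s | P i) F i) h = \sum_(i <- s | P i) B (F i) h.
Proof.
by elim/big_rec2: _ => [|i x y _ <-]; rewrite ?psd0l// psdDl.
Qed.

Lemma psd_sumr I (s : seq I) (P : pred I) (F : I -> V) h :
  B h (\sum_(i <- s | P i) F i) = \sum_(i <- s | P i) B h (F i).
Proof.
by elim/big_rec2: _ => [|i x y _ <-]; rewrite ?psd0r// psdDr.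
Qed.

Lemma psd_diag f : B f f = (n f ^+ 2)%:C.
Proof.
have := psd_ge0 hB f; rewrite lecE => /andP[/eqP im re].
rewrite sqr_sqrtr//; case: (B f f) im re => a b /= -> _; exact: complexr0.
Qed.

Lemma sn_sqr f : n f ^+ 2 = complex.Re (B f f).
Proof. by rewrite psd_diag. Qed.

Lemma sn0 : n 0 = 0.
Proof. by rewrite /sn psd0l /= sqrtr0. Qed.

Lemma snZ a f : n (a *: f) = cabs a * n f.
Proof.
apply/eqP; rewrite -(@eqrXn2 _ 2%N)//; last by rewrite mulr_ge0 ?sn_ge0 ?cabs_ge0.
  by rewrite sn_sqr psdZl psdZr mulrA mul_conj psd_diag -rmorphM/= exprMn.
exact: sn_ge0.
Qed.

Lemma snN f : n (- f) = n f.
Proof. by rewrite -scaleN1r snZ cabsN cabs1 mul1r. Qed.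

Lemma snBC f g : n (f - g) = n (g - f).
Proof. by rewrite -snN opprB. Qed.

Lemma sn_sqrD f g : n (f + g) ^+ 2 = n f ^+ 2 + n g ^+ 2 + 2 * complex.Re (B f g).
Proof.
rewrite !sn_sqr psdDl !psdDr (psd_herm hB f g).
by case: (B f g) => a b; rewrite !raddfD/=; ring.
Qed.

(** The form is nonnegative at [f - t (B f g) g] for every real [t].  If [g] is a
    null vector this is affine in [t], so that [B f g = 0]; otherwise the best
    choice is [t = n g ^- 2]. *)
Lemma psd_CS f g : cabs (B f g) <= n f * n g.
Proof.
set m := cabs _; set F := n f; set G := n g.
have key t : 0 <= F ^+ 2 - 2 * t * m ^+ 2 + t ^+ 2 * m ^+ 2 * G ^+ 2.
  have := sqr_ge0 (n (f + (- t%:C * B f g) *: g)).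
  have E : (- t%:C * B f g)^* * B f g = (- (t * m ^+ 2))%:C.
    rewrite rmorphM rmorphN /= conj_real -mulrA (mulrC (B f g)^*) mul_conj.
    by rewrite -rmorphN -rmorphM mulNr.
  rewrite sn_sqrD snZ psdZr E cabsM cabsN cabs_real !exprMn /=.
  rewrite -/m -/F -/G real_normK ?num_real//.
  by move=> /le_trans; apply; rewrite le_eqVlt; apply/orP; left; apply/eqP; ring.
rewrite -(@ler_pXn2r _ 2%N)//; last first.
- by rewrite nnegrE mulr_ge0 ?sn_ge0.
- by rewrite nnegrE cabs_ge0.
rewrite exprMn; have [G0|G0] := eqVneq G 0.
  have [->|m0] := eqVneq m 0; first by rewrite expr0n mulr_ge0 ?sqr_ge0.
  (* any t with 2 t m ^ 2 > F ^ 2 contradicts key *)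
  have := key ((F ^+ 2 + 1) / (2 * m ^+ 2)); rewrite G0 expr0n mulr0 addr0.
  rewrite [2 * _]mulrC -!mulrA mulVf ?mulr1 ?mulf_neq0 ?expf_neq0 ?pnatr_eq0//.
  lra.
have := key (G ^+ 2)^-1.
have G2 : 0 < G ^+ 2 by rewrite exprn_gt0// lt_def G0 sn_ge0.
set u := G ^+ 2 in G2 *.
have -> : u^-1 ^+ 2 * m ^+ 2 * u = u^-1 * m ^+ 2.
  by field; rewrite gt_eqF.
have -> : F ^+ 2 - 2 * u^-1 * m ^+ 2 + u^-1 * m ^+ 2 = F ^+ 2 - m ^+ 2 / u by ring.
by rewrite subr_ge0 ler_pdivrMr.
Qed.

Lemma snD f g : n (f + g) <= n f + n g.
Proof.
rewrite -(@ler_pXn2r _ 2%N) ?nnegrE ?addr_ge0 ?sn_ge0//.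
have := le_trans (ler_norm _) (le_trans (cabs_Re _) (psd_CS f g)).
by rewrite sn_sqrD sqrrD; lra.
Qed.

Lemma snB f g : n (f - g) <= n f + n g.
Proof. by rewrite (le_trans (snD _ _))// snN. Qed.

Lemma sn_dist f g : `|n f - n g| <= n (f - g).
Proof.
have := snD (f - g) g; have := snD (g - f) f; rewrite !subrK snBC ler_norml.
lra.
Qed.

Lemma sn_triangle h f g : n (f - g) <= n (f - h) + n (g - h).
Proof. by rewrite [n (g - h)]snBC (le_trans _ (snD _ _))// addrA subrK. Qed.

Lemma sn_lincomb a f g f' g' :
  n (a *: f + g - (a *: f' + g')) <= cabs a * n (f - f') + n (g - g').
Proof. by rewrite opprD addrACA -scalerBr (le_trans (snD _ _))// snZ. Qed.

Lemma sn_sum I (s : seq I) (P : pred I) (F : I -> V) :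
  n (\sum_(i <- s | P i) F i) <= \sum_(i <- s | P i) n (F i).
Proof.
elim/big_rec2: _ => [|i x z _ h]; first by rewrite sn0.
by rewrite (le_trans (snD _ _))// lerD2l.
Qed.

(** Pythagoras. *)
Lemma sn_sqr_orthogonal (u : nat -> V) (c : nat -> R[i]) (s : seq nat) :
  uniq s -> (forall i j, i != j -> B (u i) (u j) = 0) ->
  n (\sum_(i <- s) c i *: u i) ^+ 2 =
  \sum_(i <- s) cabs (c i) ^+ 2 * n (u i) ^+ 2.
Proof.
move=> us ou; elim: s us => [|i s IH] /=; first by rewrite !big_nil sn0 expr0n.
move=> /andP[si us]; rewrite !big_cons sn_sqrD IH// snZ exprMn.
suff -> : B (c i *: u i) (\sum_(j <- s) c j *: u j) = 0 by rewrite mulr0 addr0.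
rewrite psd_sumr big_seq big1 // => j js.
by rewrite psdZl psdZr ou ?mulr0//; apply: contraNneq si => ->.
Qed.

End Theory.
End PsdForms.

(** * Riesz products as forms on polynomials *)
Section RieszProducts.
Variable R : realType.
Local Notation C := R[i].
Implicit Types f g : {poly C}.

Definition l1 (p : {poly C}) : R := \sum_(i < size p) cabs p`_i.

Lemma l1_ge0 p : 0 <= l1 p.
Proof. by apply: sumr_ge0 => i _; exact: cabs_ge0. Qed.

Section ShiftInvariant.
Variable B : {poly C} -> {poly C} -> C.
Hypothesis hB : psd_form B.
Hypothesis shB : forall f g, B ('X * f) ('X * g) = B f g.
Local Notation n := (sn B).

Lemma shiftXn m f g : B ('X^m * f) ('X^m * g) = B f g.
Proof.
by elim: m => [|m IH]; rewrite ?expr0 ?mul1r// exprS -!mulrA shB.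
Qed.

Lemma sn_Xn m f : n ('X^m * f) = n f.
Proof. by rewrite /sn shiftXn. Qed.

(** Multiplication by a monomial is isometric, so [p] acts with norm at most the
    sum of the moduli of its coefficients. *)
Lemma sn_mul p f : n (p * f) <= l1 p * n f.
Proof.
rewrite -[p in leLHS]coefK poly_def mulr_suml (le_trans (sn_sum hB _ _ _))//.
rewrite /l1 mulr_suml ler_sum// => i _.
by rewrite -scalerAl (snZ hB) sn_Xn.
Qed.

(** If [B] is the Gram form of a measure on the circle, this is the Gram form of
    its product with the weight [1 + 2 e Re (conj p z^N)]. *)
Definition riesz_step (p : {poly C}) (e : R) (N : nat) (f g : {poly C}) : C :=
  B f g + e%:C * (B (p * f) ('X^N * g) + B ('X^N * f) (p * g)).

(** By Cauchy-Schwarz and shift invariance the correction at [f, f] is at most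
    [2 e (l1 p) (B f f)] in modulus. *)
Lemma riesz_step_psd p e N :
  0 <= e -> e * l1 p <= 2^-1 -> psd_form (riesz_step p e N).
Proof.
move=> e0 ep; split.
- move=> a f g h; rewrite /riesz_step !mulrDr -!scalerAr !(psd_linear hB); ring.
- move=> f g; rewrite /riesz_step rmorphD rmorphM rmorphD/= -!(psd_herm hB).
  by rewrite conj_real [X in _ * X]addrC.
- move=> f; rewrite /riesz_step (psd_herm hB (p * f) ('X^N * f)).
  set z := B (p * f) _.
  have zq : cabs z <= l1 p * n f ^+ 2.
    rewrite (le_trans (psd_CS hB _ _))// sn_Xn expr2 mulrA ler_wpM2r ?sn_ge0//.
    exact: sn_mul.
  have -> : z + z^* = (2 * complex.Re z)%:C.
    by rewrite rmorphM/= rmorph_nat -addcJ.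
  rewrite (psd_diag hB) -rmorphM -rmorphD ler0c/=.
  have := le_trans (cabs_Re z) zq; rewrite ler_norml => /andP[h _].
  have h1 : e * - (l1 p * n f ^+ 2) <= e * complex.Re z by rewrite ler_wpM2l.
  have h2 : e * l1 p * n f ^+ 2 <= 2^-1 * n f ^+ 2 by rewrite ler_wpM2r ?sqr_ge0.
  lra.
Qed.

End ShiftInvariant.

(** The Gram form of Lebesgue measure, at which the product starts. *)
Definition l2form (f g : {poly C}) : C := \sum_(i < size f) f`_i * (g`_i)^*.

Lemma l2form_wide n f g : (size f <= n)%N ->
  l2form f g = \sum_(i < n) f`_i * (g`_i)^*.
Proof.
move=> fn; rewrite /l2form (big_ord_widen n (fun i => f`_i * (g`_i)^*)) //.
rewrite big_mkcond /=; apply: eq_bigr => i _; case: ltnP => // h.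
by rewrite nth_default// mul0r.
Qed.

Lemma l2form_psd : psd_form l2form.
Proof.
split.
- move=> a f g h; set n := maxn (size (a *: f + g)) (maxn (size f) (size g)).
  rewrite !(@l2form_wide n) ?leq_max ?leqnn ?orbT// mulr_sumr -big_split/=.
  by apply: eq_bigr => i _; rewrite coefD coefZ mulrDl mulrA.
- move=> f g; set n := maxn (size f) (size g).
  rewrite !(@l2form_wide n) ?leq_max ?leqnn ?orbT// rmorph_sum/=.
  by apply: eq_bigr => i _; rewrite rmorphM/= conjCK mulrC.
- by move=> f; apply: sumr_ge0 => i _; exact: mul_conjC_ge0.
Qed.

Lemma l2form_shift f g : l2form ('X * f) ('X * g) = l2form f g.
Proof.
rewrite (@l2form_wide (size f).+1); last first.
  by rewrite (leq_trans (size_polyMleq _ _))// size_polyX.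
rewrite big_ord_recl/= !coefXM mul0r add0r.
by apply: eq_bigr => i _; rewrite !coefXM.
Qed.

Lemma l2form_band f g m : (size f <= m)%N -> l2form f ('X^m * g) = 0.
Proof.
move=> fm; apply: big1 => i _.
by rewrite coefXnM (leq_trans (ltn_ord i) fm) rmorph0 mulr0.
Qed.

Variables (p : nat -> {poly C}) (eps : nat -> R).
Hypothesis eps_ge0 : forall k, 0 <= eps k.
Hypothesis eps_l1 : forall k, eps k * l1 (p k) <= 2^-1.

(** [width k] bounds the bandwidth of [rform k] ([rform_band]) and the degree of
    [p k].  The frequency [3 * width k + 1] keeps the products of [p k] with
    polynomials of degree [width k] out of the reach of [rform k]. *)
Fixpoint width k : nat :=
  if k is k'.+1 then (5 * width k' + 1 + size (p k))%N else size (p 0%N).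

Definition freq k := (3 * width k + 1)%N.

Fixpoint rform k : {poly C} -> {poly C} -> C :=
  if k is k'.+1 then riesz_step (rform k') (p k') (eps k') (freq k')
  else l2form.

Lemma widthS k : width k.+1 = (5 * width k + 1 + size (p k.+1))%N.
Proof. by []. Qed.

Lemma rformS k f g : rform k.+1 f g =
  rform k f g + (eps k)%:C *
    (rform k (p k * f) ('X^(freq k) * g) + rform k ('X^(freq k) * f) (p k * g)).
Proof. by []. Qed.

Lemma size_width k : (size (p k) <= width k)%N.
Proof. by case: k => [|k] //; rewrite widthS leq_addl. Qed.

Lemma width_leS k : (width k < width k.+1)%N.
Proof. by rewrite widthS; lia. Qed.

Lemma width_mono : {homo width : j k / (j <= k)%N}.
Proof.
apply: homo_leq => [//|j k l h1 h2|k]; first exact: leq_trans h1 h2.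
exact/ltnW/width_leS.
Qed.

Lemma leq_width k : (k <= width k)%N.
Proof. by elim: k => // k IH; rewrite (leq_ltn_trans IH)// width_leS. Qed.

Lemma rform_shift k f g : rform k ('X * f) ('X * g) = rform k f g.
Proof.
elim: k f g => [|k IH] f g /=; first exact: l2form_shift.
by rewrite /riesz_step !(mulrCA _ 'X) !IH.
Qed.

Lemma rform_psd k : psd_form (rform k).
Proof.
elim: k => [|k IH] /=; first exact: l2form_psd.
apply: riesz_step_psd => //; exact: rform_shift.
Qed.

(** The weight of [rform k] has its spectrum in [[-width k, width k]], so monomials
    whose degrees are further apart are orthogonal. *)
Lemma rform_band k f g m :
  (size f + width k <= m)%N -> rform k f ('X^m * g) = 0.
Proof.
elim: k f g m => [|k IH] f g m h.
  by apply: l2form_band; exact: leq_trans (leq_addr _ _) h.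
have hp := size_width k.
have h1 := size_polyMleq (p k) f; have h2 := size_polyMleq 'X^(freq k) f.
rewrite size_polyXn /freq in h2; rewrite widthS in h; rewrite rformS /freq.
have e1 : 'X^(3 * width k + 1) * ('X^m * g) = 'X^(3 * width k + 1 + m) * g.
  by rewrite mulrA -exprD.
rewrite e1 (mulrCA (p k)) !IH ?addr0 ?mulr0 ?addr0//; lia.
Qed.

Lemma rform_bandl k f g m :
  (size f + width k <= m)%N -> rform k ('X^m * g) f = 0.
Proof. by move=> h; rewrite (psd_herm (rform_psd k)) rform_band// rmorph0. Qed.

(** The [k]-th factor only adds frequencies near [freq k] and [- freq k], which do
    not occur in [f * conj g] when both degrees are at most [width k]. *)
Lemma rform_stable k f g :
  (size f <= (width k).+1)%N -> (size g <= (width k).+1)%N ->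
  rform k.+1 f g = rform k f g.
Proof.
move=> hf hg; have hp := size_width k.
have h1 := size_polyMleq (p k) f; have h2 := size_polyMleq (p k) g.
rewrite rformS rform_band ?rform_bandl ?addr0 ?mulr0 ?addr0//; rewrite /freq; lia.
Qed.

(** The limit of the stationary sequence [rform k f g]; the stage
    [size f + size g] is one at which stationarity is already guaranteed. *)
Definition rlim f g := rform (size f + size g) f g.

Lemma rlimE k f g :
  (size f <= (width k).+1)%N -> (size g <= (width k).+1)%N ->
  rlim f g = rform k f g.
Proof.
move=> hf hg.
have stab j d : (size f <= (width j).+1)%N -> (size g <= (width j).+1)%N ->
    rform (d + j) f g = rform j f g.
  move=> jf jg; elim: d => // d IH; rewrite addSn rform_stable//.
  - by rewrite (leq_trans jf)// ltnS width_mono// leq_addl.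
  - by rewrite (leq_trans jg)// ltnS width_mono// leq_addl.
rewrite /rlim; set s := (size f + size g)%N.
have sf : (size f <= (width s).+1)%N.
  exact: leq_trans (leq_addr _ _) (leqW (leq_width s)).
have sg : (size g <= (width s).+1)%N.
  exact: leq_trans (leq_addl _ _) (leqW (leq_width s)).
by rewrite -(stab s k sf sg) -(stab k s hf hg) addnC.
Qed.

Lemma rlim_wide k f g : (size f <= k)%N -> (size g <= k)%N ->
  rlim f g = rform k f g.
Proof.
by move=> hf hg; apply: rlimE; rewrite (leq_trans _ (leqW (leq_width k))).
Qed.

Lemma rlim_psd : psd_form rlim.
Proof.
split.
- move=> a f g h; set k := maxn (size (a *: f + g)) (maxn (size h) (maxn (size f) (size g))).
  by rewrite !(@rlim_wide k) ?leq_max ?leqnn ?orbT// (psd_linear (rform_psd k)).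
- move=> f g; set k := maxn (size f) (size g).
  rewrite !(@rlim_wide k) ?leq_max ?leqnn ?orbT//; exact: (psd_herm (rform_psd k)).
- by move=> f; rewrite (@rlim_wide (size f))//; exact: (psd_ge0 (rform_psd _)).
Qed.

Lemma rlim_shift f g : rlim ('X * f) ('X * g) = rlim f g.
Proof.
set k := maxn (size ('X * f)) (maxn (size ('X * g)) (maxn (size f) (size g))).
by rewrite !(@rlim_wide k) ?leq_max ?leqnn ?orbT// rform_shift.
Qed.

Lemma rlim11 : rlim 1 1 = 1.
Proof.
rewrite (@rlimE 0) ?size_poly1// /= /l2form size_poly1 big_ord1 coef1 eqxx.
by rewrite conjC1; exact: mulr1.
Qed.

Lemma sn_rlimX m : sn rlim 'X^m = 1.
Proof.
have -> : 'X^m = 'X^m * 1 :> {poly C} by rewrite mulr1.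
by rewrite (sn_Xn rlim_shift) /sn rlim11 sqrtr1.
Qed.

(** The projection of [z^N_k] on the polynomials of low degree is [eps_k p_k]: of
    the three terms of the [k]-th step only the one where both powers of [z^N_k]
    cancel survives. *)
Lemma rlim_freq k g : (size g <= (width k).+1)%N ->
  rlim 'X^(freq k) g = (eps k)%:C * rlim (p k) g.
Proof.
move=> hg; have hp := size_width k; have h1 := size_polyMleq (p k) g.
rewrite (@rlimE k.+1); last first.
- by rewrite (leq_trans hg)// ltnS ltnW// width_leS.
- by rewrite size_polyXn /freq widthS; lia.
rewrite (@rlimE k (p k) g)//; last by lia.
rewrite rformS -[X in rform k X g]mulr1 rform_bandl; last by rewrite /freq; lia.
rewrite -exprD -['X^(_ + _)]mulr1 rform_bandl; last by rewrite /freq; lia.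
rewrite add0r addr0 [p k * _]mulrC shiftXn//; exact: rform_shift.
Qed.

Definition resid k := 'X^(freq k) - (eps k)%:C *: p k.

Lemma rlim_resid k g : (size g <= (width k).+1)%N -> rlim (resid k) g = 0.
Proof.
move=> hg; rewrite (psdBl rlim_psd) (psdZl rlim_psd) rlim_freq//.
by rewrite subrr.
Qed.

Lemma size_resid k : (size (resid k) <= (width k.+1).+1)%N.
Proof.
rewrite (leq_trans (size_polyD _ _))// geq_max size_polyXn size_polyN.
apply/andP; split; first by rewrite /freq widthS; lia.
rewrite (leq_trans (size_scale_leq _ _))// (leq_trans (size_width k))//.
by rewrite (leq_trans (ltnW (width_leS k))).
Qed.

(** The earlier residual has low degree for the later one. *)
Lemma resid_orthogonal j k : j != k -> rlim (resid j) (resid k) = 0.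
Proof.
have lt_orth i l : (i < l)%N -> rlim (resid l) (resid i) = 0.
  move=> il; apply: rlim_resid; rewrite (leq_trans (size_resid i))// ltnS.
  exact: width_mono.
rewrite neq_ltn => /orP[/lt_orth h|/lt_orth//].
by rewrite (psd_herm rlim_psd) h rmorph0.
Qed.

Lemma sn_resid k : sn rlim (resid k) <= 2.
Proof.
rewrite (le_trans (snB rlim_psd _ _))// sn_rlimX (snZ rlim_psd) cabs_real.
rewrite ger0_norm//; have := sn_mul rlim_psd rlim_shift (p k) 1.
rewrite mulr1.
have -> : sn rlim 1 = 1 by rewrite /sn rlim11 sqrtr1.
rewrite mulr1 => h.
have := ler_wpM2l (eps_ge0 k) h; have := eps_l1 k; lra.
Qed.

(** A Fourier coefficient in this range vanishes before the [k]-th factor comes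
    in and is not changed after it, so it is as small as that factor. *)
Lemma rlim_corr k n : (width k < n <= width k.+1)%N ->
  cabs (rlim 'X^n 1) <= eps k * l1 (p k).
Proof.
move=> /andP[kn nk]; have hp := size_width k.
have hX1 (m : nat) : 'X^m = 'X^m * 1 :> {poly C} by rewrite mulr1.
rewrite (@rlimE k.+1) ?size_polyXn ?ltnS// ?size_poly1// rformS.
rewrite [X in rform k X]hX1 rform_bandl ?size_poly1// add0r.
rewrite mulr1 -exprD [X in _ + rform k X _]hX1 rform_bandl; last by rewrite mulr1 /freq; lia.
rewrite addr0 cabsM cabs_real ger0_norm// ler_wpM2l//.
rewrite (le_trans (psd_CS (rform_psd k) _ _))//.
have s1 : sn (rform k) 1 = 1.
  by rewrite /sn -rlimE ?size_poly1// rlim11 sqrtr1.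
have sX m : sn (rform k) 'X^m = 1.
  by rewrite hX1 (sn_Xn (@rform_shift k)).
by rewrite sX mulr1 (le_trans (sn_mul (rform_psd k) (@rform_shift k) _ _))// sX mulr1.
Qed.

End RieszProducts.

(** * Limits with an explicit rate *)
Section Rates.
Variable R : realType.
Implicit Types (x y c e : R).

Definition rate k : R := k.+1%:R^-1.

Lemma rate_gt0 k : 0 < rate k.
Proof. by rewrite invr_gt0 ltr0n. Qed.

Lemma rate_small e : 0 < e -> exists k, rate k < e.
Proof.
move=> e0; exists (Num.truncn e^-1); rewrite /rate invf_plt ?posrE ?ltr0n//.
exact: truncnS_gt.
Qed.

Lemma ler_addrate x y c : (forall k, x <= y + c * rate k) -> x <= y.
Proof.
move=> h; apply/ler_addgt0Pr => e e0.
have d0 : 0 < `|c| + 1 by rewrite ltr_wpDl.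
have [k hk] := rate_small (divr_gt0 e0 d0).
apply: (le_trans (h k)); rewrite lerD2l.
rewrite (le_trans (ler_norm _))// normrM (ger0_norm (ltW (rate_gt0 k))).
have h1 : (`|c| + 1) * rate k <= e.
  by rewrite mulrC -ler_pdivlMr// ltW.
by apply: le_trans h1; rewrite ler_wpM2r ?lerDl// ltW ?rate_gt0.
Qed.

(** The supremum of the lower bounds [u k - c / (k + 1)] lies below all the upper
    bounds [u k + c / (k + 1)]. *)
Lemma real_rate_limit (u : nat -> R) c :
  (forall k l, `|u k - u l| <= c * (rate k + rate l)) ->
  exists r, forall k, `|r - u k| <= c * rate k.
Proof.
move=> h; pose E := [set u k - c * rate k | k in [set: nat]]%classic.
have ubE l : ubound E (u l + c * rate l).
  by move=> _ [k _ <-]; have := h k l; rewrite ler_norml mulrDr; lra.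
have E0 : (E !=set0)%classic by exists (u 0%N - c * rate 0); exists 0%N.
exists (sup E) => k; rewrite ler_norml.
have h1 : sup E <= u k + c * rate k by apply: ge_sup.
have h2 : u k - c * rate k <= sup E.
  apply: ub_le_sup; last by exists k.
  by exists (u k + c * rate k).
lra.
Qed.

Lemma complex_rate_limit (u : nat -> R[i]) c :
  (forall k l, cabs (u k - u l) <= c * (rate k + rate l)) ->
  exists z, forall k, cabs (z - u k) <= 2 * c * rate k.
Proof.
move=> h.
have [r hr] : exists r, forall k, `|r - complex.Re (u k)| <= c * rate k.
  apply: real_rate_limit => k l; apply: le_trans (h k l).
  by rewrite -raddfB cabs_Re.
have [s hs] : exists r, forall k, `|r - complex.Im (u k)| <= c * rate k.
  apply: real_rate_limit => k l; apply: le_trans (h k l).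
  by rewrite -raddfB cabs_Im.
exists (r +i* s)%C => k; rewrite (le_trans (cabs_ReIm _))//.
have := lerD (hr k) (hs k); rewrite !raddfB /=; lra.
Qed.

End Rates.

(** * Completion of a space with a positive semidefinite form *)
Section GNS.
Variables (R : realType) (V : lmodType R[i]) (B : V -> V -> R[i]).
Hypothesis hB : psd_form B.
Local Notation n := (sn B).

(** A vector [x] of the completion is identified with the functional
    [v |-> <x, v>], so that null vectors are divided out for free.  The completion
    is the closure of the functionals [B f] for the dual norm. *)
Definition approx (phi : V -> R[i]) f e :=
  forall v, cabs (phi v - B f v) <= e * n v.

Definition gns_pred : {pred V -> R[i]^o} :=
  fun phi => `[< forall e, 0 < e -> exists f, approx phi f e >].

Lemma gns_submod : submod_closed gns_pred.
Proof.
split.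
  apply/asboolP => e e0; exists 0 => v.
  by rewrite (psd0l hB) subr0 cabs0 mulr_ge0 ?sn_ge0// ltW.
move=> a phi psi /asboolP hphi /asboolP hpsi; apply/asboolP => e e0.
have d0 : 0 < e / 2 / (cabs a + 1) by rewrite !divr_gt0// ltr_wpDl// cabs_ge0.
have e2 : 0 < e / 2 by rewrite divr_gt0.
have [f hf] := hphi _ d0; have [g hg] := hpsi _ e2.
exists (a *: f + g) => v.
have -> : (a *: phi + psi) v - B (a *: f + g) v =
    a * (phi v - B f v) + (psi v - B g v).
  by rewrite (psd_linear hB) mulrBr addrACA opprD.
rewrite (le_trans (cabsD _ _))// cabsM.
have h1 : cabs a * cabs (phi v - B f v) <= e / 2 * n v.
  apply: (@le_trans _ _ ((cabs a + 1) * (e / 2 / (cabs a + 1) * n v))).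
    apply: ler_pM; rewrite ?cabs_ge0 ?lerDl//; exact: hf.
  by rewrite mulrA [(_ + 1) * _]mulrC divfK// gt_eqF// ltr_wpDl// cabs_ge0.
by have := lerD h1 (hg v); rewrite -mulrDl -splitr.
Qed.

HB.instance Definition _ :=
  GRing.isSubmodClosed.Build R[i] (V -> R[i]^o) gns_pred gns_submod.

Record gns := Gns { gns_val :> V -> R[i]^o ; gns_valP : gns_val \in gns_pred }.
HB.instance Definition _ := [isSub for gns_val].
HB.instance Definition _ := [Choice of gns by <:].
HB.instance Definition _ := [SubChoice_isSubLmodule of gns by <:].

Implicit Types (phi psi : gns) (f g v : V) (e : R).

Lemma gns_ext phi psi : (forall v, phi v = psi v) -> phi = psi.
Proof. by move=> h; apply/val_inj/funext. Qed.

Lemma gnsE a phi psi v : (a *: phi + psi) v = a * phi v + psi v.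
Proof. by []. Qed.

Lemma gnsD phi psi v : (phi + psi) v = phi v + psi v.
Proof. by []. Qed.

Lemma gnsB phi psi v : (phi - psi) v = phi v - psi v.
Proof. by []. Qed.

Lemma gnsZ a phi v : (a *: phi) v = a * phi v.
Proof. by []. Qed.

Lemma gns0 v : (0 : gns) v = 0.
Proof. by []. Qed.

Fact iota_subproof f : (B f : V -> R[i]^o) \in gns_pred.
Proof.
apply/asboolP => e e0; exists f => v.
by rewrite subrr cabs0 mulr_ge0 ?sn_ge0// ltW.
Qed.

Definition iota f : gns := Gns (iota_subproof f).

Lemma iotaE f v : iota f v = B f v. Proof. by []. Qed.

Lemma iota_linear : linear iota.
Proof. by move=> a f g; apply: gns_ext => v; rewrite gnsE !iotaE (psd_linear hB). Qed.

HB.instance Definition _ := GRing.isLinear.Build R[i] V gns _ iota iota_linear.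

Definition gns_bound phi : set R :=
  [set c | 0 <= c /\ forall v, cabs (phi v) <= c * n v]%classic.

(** The dual norm. *)
Definition gnorm phi : R := inf (gns_bound phi).
Local Notation N := gnorm.

Lemma gns_bound_inf phi : has_inf (gns_bound phi).
Proof.
split; last by exists 0 => c [].
have /asboolP/(_ 1 ltr01)[f hf] := valP phi.
exists (1 + n f); split; first by rewrite addr_ge0 ?sn_ge0.
move=> v; rewrite -[phi v](subrK (B f v)) (le_trans (cabsD _ _))//.
by rewrite mulrDl lerD ?psd_CS//; exact: hf.
Qed.

Lemma gnorm_ge0 phi : 0 <= N phi.
Proof.
by apply: lb_le_inf => [|c []//]; case: (gns_bound_inf phi).
Qed.

Lemma gnormP phi v : cabs (phi v) <= N phi * n v.
Proof.
have [v0|v0] := eqVneq (n v) 0.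
  have [[c [c0 hc]] _] := gns_bound_inf phi.
  by have := hc v; rewrite v0 !mulr0.
have vpos : 0 < n v by rewrite lt_def v0 sn_ge0.
rewrite -ler_pdivrMr//; apply: lb_le_inf; first by case: (gns_bound_inf phi).
by move=> c [_ hc]; rewrite ler_pdivrMr.
Qed.

Lemma gnorm_le phi c : 0 <= c -> (forall v, cabs (phi v) <= c * n v) -> N phi <= c.
Proof. by move=> c0 hc; apply: ge_inf => //; case: (gns_bound_inf phi). Qed.

Lemma gnormD phi psi : N (phi + psi) <= N phi + N psi.
Proof.
apply: gnorm_le => [|v]; first by rewrite addr_ge0 ?gnorm_ge0.
by rewrite gnsD (le_trans (cabsD _ _))// mulrDl lerD ?gnormP.
Qed.

Lemma gnormZ a phi : N (a *: phi) = cabs a * N phi.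
Proof.
have le b psi : N (b *: psi) <= cabs b * N psi.
  apply: gnorm_le => [|v]; first by rewrite mulr_ge0 ?cabs_ge0 ?gnorm_ge0.
  by rewrite gnsZ cabsM -mulrA ler_wpM2l ?cabs_ge0 ?gnormP.
apply/eqP; rewrite eq_le le /=.
have [->|a0] := eqVneq a 0; first by rewrite cabs0 mul0r gnorm_ge0.
have := le a^-1 (a *: phi); rewrite scalerA mulVf// scale1r cabsV.
by rewrite ler_pdivlMl// lt_def cabs_eq0 a0 cabs_ge0.
Qed.

Lemma gnorm_eq0 phi : N phi = 0 -> phi = 0.
Proof.
move=> h; apply: gns_ext => v; apply/eqP; rewrite gns0 -cabs_eq0.
by rewrite eq_le cabs_ge0 (le_trans (gnormP _ _))// h mul0r.
Qed.

Lemma gnorm0 : N 0 = 0.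
Proof. by rewrite -(scale0r 0) gnormZ cabs0 mul0r. Qed.

Lemma gnormN phi : N (- phi) = N phi.
Proof. by rewrite -scaleN1r gnormZ cabsN cabs1 mul1r. Qed.

Lemma gnormBC phi psi : N (phi - psi) = N (psi - phi).
Proof. by rewrite -gnormN opprB. Qed.

Lemma gnorm_dist chi phi psi : N (phi - psi) <= N (phi - chi) + N (psi - chi).
Proof. by rewrite [N (psi - _)]gnormBC (le_trans _ (gnormD _ _))// addrA subrK. Qed.

Lemma gnorm_iota f : N (iota f) = n f.
Proof.
apply/eqP; rewrite eq_le; apply/andP; split.
  by apply: gnorm_le; rewrite ?sn_ge0// => v; exact: psd_CS.
have [f0|f0] := eqVneq (n f) 0; first by rewrite f0 gnorm_ge0.
have fpos : 0 < n f by rewrite lt_def f0 sn_ge0.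
rewrite -(ler_pM2r fpos) (le_trans _ (gnormP _ _))// iotaE (psd_diag hB).
by rewrite cabs_real ger0_norm ?sqr_ge0.
Qed.

Lemma iota_dense phi e : 0 < e -> exists f, N (phi - iota f) <= e.
Proof.
move=> e0; have /asboolP/(_ e e0)[f hf] := valP phi.
by exists f; apply: gnorm_le => [|v]; [exact: ltW|exact: hf].
Qed.

(** Additivity holds for the functionals [B f] and survives uniform limits. *)
Lemma gns_addr phi f g : phi (f - g) = phi f - phi g.
Proof.
apply/eqP; rewrite -subr_eq0; apply/eqP.
apply: (@cabs_small_eq0 _ _ (n (f - g) + n f + n g)) => e e0.
have [h hh] := iota_dense phi e0.
have b v : cabs ((phi - iota h) v) <= n v * e.
  by rewrite (le_trans (gnormP _ _))// mulrC ler_wpM2l ?sn_ge0.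
have -> : phi (f - g) - (phi f - phi g) = (phi - iota h) (f - g) +
   (- (phi - iota h) f + (phi - iota h) g).
  by rewrite !gnsB !iotaE (psdBr hB); ring.
rewrite (le_trans (cabsD _ _))// -addrA mulrDl lerD//.
by rewrite (le_trans (cabsD _ _))// cabsN mulrDl lerD.
Qed.

(** The inner product of [phi] and [psi] is the limit of [phi g] as [g] tends to
    [psi].  This estimate determines it, and all its properties are derived from
    the estimate by density. *)
Lemma gip_ex phi psi :
  exists z, forall g, cabs (z - phi g) <= N phi * N (psi - iota g).
Proof.
have /choice[G hG] k := iota_dense psi (rate_gt0 R k).
have bd f g : cabs (phi f - phi g) <= N phi * (N (psi - iota f) + N (psi - iota g)).
  rewrite -gns_addr (le_trans (gnormP _ _))// ler_wpM2l ?gnorm_ge0//.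
  rewrite -gnorm_iota raddfB/= gnormBC (le_trans (gnorm_dist psi _ _))//.
  by rewrite !(gnormBC psi) addrC.
have [z hz] : exists z, forall k, cabs (z - phi (G k)) <= 2 * N phi * rate R k.
  apply: complex_rate_limit => k l; rewrite (le_trans (bd _ _))//.
  by rewrite ler_wpM2l ?gnorm_ge0// lerD.
exists z => g; apply: (@ler_addrate _ _ _ (3 * N phi)) => k.
rewrite -[z](subrK (phi (G k))) -addrA (le_trans (cabsD _ _))//.
have := lerD (hz k) (bd (G k) g).
have := ler_wpM2l (gnorm_ge0 phi) (hG k); lra.
Qed.

Definition gip phi psi : R[i] := sval (cid (gip_ex phi psi)).

Lemma gipP phi psi g : cabs (gip phi psi - phi g) <= N phi * N (psi - iota g).
Proof. exact: (svalP (cid (gip_ex phi psi))). Qed.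

Lemma gip_linear a phi phi' psi :
  gip (a *: phi + phi') psi = a * gip phi psi + gip phi' psi.
Proof.
apply/eqP; rewrite -subr_eq0; apply/eqP.
set chi := a *: phi + phi'.
apply: (@cabs_small_eq0 _ _ (N chi + cabs a * N phi + N phi')) => e e0.
have [g hg] := iota_dense psi e0.
have b x : cabs (gip x psi - x g) <= N x * e.
  by rewrite (le_trans (gipP _ _ g))// ler_wpM2l ?gnorm_ge0.
have -> : gip chi psi - (a * gip phi psi + gip phi' psi) =
   (gip chi psi - chi g) + (- (a * (gip phi psi - phi g)) - (gip phi' psi - phi' g)).
  by rewrite gnsE; ring.
rewrite (le_trans (cabsD _ _))// -addrA mulrDl lerD//.
rewrite (le_trans (cabsD _ _))// !cabsN mulrDl lerD// cabsM -mulrA.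
by rewrite ler_wpM2l ?cabs_ge0.
Qed.

Lemma gip_approx phi psi f g e : e <= 1 ->
  N (phi - iota f) <= e -> N (psi - iota g) <= e ->
  cabs (gip phi psi - B f g) <= (N phi + N psi + 1) * e.
Proof.
move=> e1 hf hg; rewrite -[gip _ _](subrK (phi g)) -addrA (le_trans (cabsD _ _))//.
have h1 : cabs (gip phi psi - phi g) <= N phi * e.
  by rewrite (le_trans (gipP _ _ g))// ler_wpM2l ?gnorm_ge0.
have h2 : cabs (phi g - B f g) <= e * n g.
  rewrite -iotaE -gnsB (le_trans (gnormP _ _))// ler_wpM2r ?sn_ge0//.
have h3 : n g <= N psi + 1.
  rewrite -gnorm_iota -[iota g](subrK psi) (le_trans (gnormD _ _))// addrC lerD2l.
  by rewrite gnormBC (le_trans hg).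
have e0 : 0 <= e by exact: le_trans (gnorm_ge0 _) hg.
have := ler_wpM2l e0 h3; lra.
Qed.

Lemma gip_iota f g : gip (iota f) (iota g) = B f g.
Proof.
apply/eqP; rewrite -subr_eq0 -cabs_eq0 eq_le cabs_ge0 andbT.
by rewrite -iotaE (le_trans (gipP _ _ g))// subrr gnorm0 mulr0.
Qed.

Lemma iota_dense2 phi psi e : 0 < e -> exists f g d,
  [/\ 0 < d, d <= 1, d <= e, N (phi - iota f) <= d & N (psi - iota g) <= d].
Proof.
move=> e0; have d0 : 0 < Num.min 1 e by rewrite lt_min ltr01.
have [f hf] := iota_dense phi d0; have [g hg] := iota_dense psi d0.
by exists f, g, (Num.min 1 e); split => //; rewrite ge_min lexx ?orbT.
Qed.

Lemma gip_herm phi psi : gip psi phi = (gip phi psi)^*.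
Proof.
apply/eqP; rewrite -subr_eq0; apply/eqP.
apply: (@cabs_small_eq0 _ _ (2 * (N phi + N psi + 1))) => e e0.
have [f [g [d [d0 d1 de hf hg]]]] := iota_dense2 phi psi e0.
have h1 := gip_approx d1 hf hg; have h2 := gip_approx d1 hg hf.
rewrite -[gip psi phi](subrK (B g f)) -addrA (le_trans (cabsD _ _))//.
have -> : B g f - (gip phi psi)^* = (B f g - gip phi psi)^*.
  by rewrite rmorphB/= -(psd_herm hB).
rewrite cabs_conj [cabs (B f g - _)]cabsB.
have h3 : (N phi + N psi + 1) * d <= (N phi + N psi + 1) * e.
  by rewrite ler_wpM2l// !addr_ge0 ?gnorm_ge0.
lra.
Qed.

Lemma gip_diag phi : gip phi phi = (N phi ^+ 2)%:C.
Proof.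
apply/eqP; rewrite -subr_eq0; apply/eqP.
apply: (@cabs_small_eq0 _ _ (4 * N phi + 2)) => e e0.
have [f [_ [d [d0 d1 de hf _]]]] := iota_dense2 phi phi e0.
have h1 := gip_approx d1 hf hf.
rewrite -[gip phi phi](subrK (B f f)) -addrA (le_trans (cabsD _ _))//.
have h2 : `|N phi - n f| <= d.
  rewrite (le_trans _ hf)// -gnorm_iota ler_norml.
  have := gnormD (phi - iota f) (iota f); have := gnormD (iota f - phi) phi.
  by rewrite !subrK gnormBC; lra.
rewrite (psd_diag hB) in h1 *; rewrite -rmorphB cabs_real.
have h3 : `|n f ^+ 2 - N phi ^+ 2| <= (2 * N phi + 1) * d.
  rewrite subr_sqr normrM distrC mulrC ler_pM//.
  rewrite ger0_norm ?addr_ge0 ?sn_ge0 ?gnorm_ge0//.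
  by move: h2; rewrite ler_norml; lra.
have h4 : (4 * N phi + 2) * d <= (4 * N phi + 2) * e.
  by rewrite ler_wpM2l// addr_ge0// mulr_ge0// gnorm_ge0.
lra.
Qed.

(** The limit is pointwise; Cauchy-Schwarz makes it uniform on the unit ball, so
    that it can still be approximated by the functionals [B f]. *)
Lemma gns_complete (u : nat -> gns) :
  (forall k l, N (u k - u l) <= rate R k + rate R l) ->
  exists phi, forall k, N (phi - u k) <= 2 * rate R k.
Proof.
move=> hu.
have lim v : exists z, forall k, cabs (z - u k v) <= 2 * n v * rate R k.
  apply: complex_rate_limit => k l; rewrite -gnsB (le_trans (gnormP _ _))//.
  by rewrite mulrC ler_wpM2l ?sn_ge0.
have [F hF] := choice lim.
have Fpred : (F : V -> R[i]^o) \in gns_pred.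
  apply/asboolP => e e0; have e4 : 0 < e / 4 by rewrite divr_gt0.
  have [k hk] := rate_small e4; have [f hf] := iota_dense (u k) e4.
  exists f => v; rewrite -[F v](subrK (u k v)) -addrA (le_trans (cabsD _ _))//.
  have h1 := hF v k.
  have h2 : cabs (u k v - B f v) <= e / 4 * n v.
    by rewrite -iotaE -gnsB (le_trans (gnormP _ _))// ler_wpM2r ?sn_ge0.
  have := mulr_ge0 (ltW e0) (sn_ge0 B v).
  have := ler_wpM2l (sn_ge0 B v) (ltW hk); lra.
exists (Gns Fpred) => k; apply: gnorm_le => [|v].
  by rewrite mulr_ge0// ltW// rate_gt0.
by rewrite gnsB (le_trans (hF v k))// mulrAC.
Qed.

Definition gns_norm phi : R[i] := (N phi)%:C.

Lemma gns_normD phi psi : gns_norm (phi + psi) <= gns_norm phi + gns_norm psi.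
Proof. by rewrite /gns_norm -rmorphD lecR gnormD. Qed.

Lemma gns_normZ a phi : gns_norm (a *: phi) = `|a| * gns_norm phi.
Proof. by rewrite /gns_norm gnormZ rmorphM normr_cabs. Qed.

Lemma gns_norm0_eq0 phi : gns_norm phi = 0 -> phi = 0.
Proof. by move=> h; apply: gnorm_eq0; apply: (@complexI R). Qed.

HB.instance Definition _ :=
  Lmodule_isNormed.Build R[i] gns gns_normD gns_normZ gns_norm0_eq0.

Lemma gns_normE phi : `|phi| = (N phi)%:C.
Proof. by []. Qed.

Lemma gns_cauchy_cvg (F : set_system gns) : ProperFilter F -> cauchy F -> cvg F.
Proof.
move=> FF /cauchyP Fc.
have /choice[x xF] k : exists x, F (ball x (rate R k)%:C).
  by apply: Fc; rewrite ltcR rate_gt0.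
have xd k phi : ball (x k) (rate R k)%:C phi -> N (x k - phi) < rate R k.
  by rewrite -ball_normE /= gns_normE ltcR.
have [k l|phi hphi] := @gns_complete x.
  have [y [/xd yk /xd yl]] := filter_ex (filterI (xF k) (xF l)).
  by rewrite (le_trans (gnorm_dist y _ _))// lerD// ltW.
apply/cvg_ex; exists phi; apply/cvgrPdist_lt => e e0.
have Re0 : 0 < complex.Re e by move: e0; rewrite ltcE /= => /andP[].
have eE : e = (complex.Re e)%:C by rewrite RRe_real// gtr0_real.
have [k hk] := rate_small (divr_gt0 Re0 (ltr0n _ 3)).
apply: filterS (xF k) => psi /xd hpsi; rewrite gns_normE eE ltcR.
have := gnorm_dist (x k) phi psi; have := hphi k; rewrite (gnormBC psi).
lra.
Qed.

HB.instance Definition _ := Uniform_isComplete.Build gns gns_cauchy_cvg.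

Lemma gip_linearl psi : linear_for *%R (gip^~ psi).
Proof. by move=> a phi phi'; exact: gip_linear. Qed.

Lemma gip_linearr phi : linear_for (Num.conj \; *%R) (gip phi).
Proof.
move=> a psi psi'; rewrite gip_herm gip_linear rmorphD rmorphM/=.
by rewrite -!(gip_herm _ phi).
Qed.

HB.instance Definition _ := isBilinear.Build R[i] gns gns R[i] _ _ gip
  (fun psi => zmod_morphism_linear (gip_linearl psi))
  (fun phi => zmod_morphism_linear (gip_linearr phi))
  (fun psi => scalable_linear (gip_linearl psi))
  (fun phi => scalable_linear (gip_linearr phi)).

Fact gip_hermitian phi psi :
  gip phi psi = (-1) ^+ false * Num.conj (gip psi phi).
Proof. by rewrite mul1r gip_herm. Qed.

HB.instance Definition _ :=
  isHermitianSesquilinear.Build R[i] gns false Num.conj gip gip_hermitian.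

Fact gip_gt0 phi : phi != 0 -> 0 < gip phi phi.
Proof.
move=> phi0; rewrite gip_diag ltcR exprn_gt0// lt_def gnorm_ge0 andbT.
by apply: contra_neq phi0; exact: gnorm_eq0.
Qed.

HB.instance Definition _ := isDotProduct.Build R[i] gns gip gip_gt0.

Theorem gns_hilbert :
  exists (H : completeNormedModType R[i]) (ip : {dot H for Num.conj})
    (i : {linear V -> H}),
    [/\ induces_norm ip, forall f g, ip (i f) (i g) = B f g &
        forall x e, 0 < e -> exists f, `|x - i f| <= e%:C].
Proof.
exists gns, gip, iota; split.
- by move=> x; rewrite [X in sqrtC X](gip_diag x) rmorphXn sqrCK// ler0c gnorm_ge0.
- exact: gip_iota.
- by move=> x e e0; have [f hf] := iota_dense x e0; exists f; rewrite gns_normE lecR.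
Qed.

End GNS.

Local Open Scope classical_set_scope.
Local Open Scope ring_scope.

(** * Hilbert space geometry *)
Section RealRadius.
Variables (R : realType) (W : normedModType R[i]).

Lemma nbhs_radiusP (x : W) (A : set W) :
  nbhs x A <-> exists2 e : R, 0 < e & forall y, `|x - y| < e%:C -> A y.
Proof.
split=> [/nbhs_ballP[e /= e0 he]|[e e0 he]].
  have eE : e = (complex.Re e)%:C by rewrite RRe_real// gtr0_real.
  exists (complex.Re e); first by move: e0; rewrite ltcE /= => /andP[].
  by move=> y hy; apply: he; rewrite -ball_normE /= eE.
apply/nbhs_ballP; exists e%:C; first by rewrite /= ltcR.
by move=> y; rewrite -ball_normE; exact: he.
Qed.

End RealRadius.

Section HilbertSpace.
Variables (R : realType) (H : completeNormedModType R[i]).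
Variable ip : {dot H for Num.conj}.
Hypothesis hn : induces_norm ip.
Local Notation n := (sn ip).
Implicit Types (x y z g : H) (e c : R).

Lemma dot_psd : psd_form ip.
Proof.
split; last exact: dnorm_ge0.
- by move=> a f g h; rewrite linearDl linearZl_LR.
- by move=> f g; rewrite (hermitian_subproof g f) mul1r.
Qed.
Let hB := dot_psd.

Lemma normr_sn x : `|x| = (n x)%:C.
Proof.
by rewrite hn (psd_diag hB) rmorphXn sqrCK// ler0c sn_ge0.
Qed.

Lemma sn_eq0 x : (n x == 0) = (x == 0).
Proof. by rewrite -(inj_eq (@complexI R)) -normr_sn normr_eq0. Qed.

Lemma sn_small_eq0 x c : (forall e, 0 < e -> n x <= c * e) -> x = 0.
Proof.
move=> h; apply/eqP; rewrite -sn_eq0; apply/eqP.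
apply: (@complexI R); apply: (@cabs_small_eq0 _ _ c) => e /h.
by rewrite cabs_real ger0_norm ?sn_ge0.
Qed.

Lemma nbhs_snP x (A : set H) :
  nbhs x A <-> exists2 e, 0 < e & forall y, n (x - y) < e -> A y.
Proof.
split=> [/nbhs_radiusP|] [e e0 he].
  by exists e => // y hy; apply: he; rewrite normr_sn ltcR.
by apply/nbhs_radiusP; exists e => // y; rewrite normr_sn ltcR; exact: he.
Qed.

Lemma hilbert_complete (u : nat -> H) c :
  (forall k l, n (u k - u l) <= c * (rate R k + rate R l)) ->
  exists x, forall k, n (x - u k) <= c * rate R k.
Proof.
move=> hu.
have : cvg (u @ \oo).
  apply: cauchy_cvg; apply: cauchy_exP => e e0.
  have Re0 : 0 < complex.Re e by move: e0; rewrite ltcE /= => /andP[].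
  have eE : e = (complex.Re e)%:C by rewrite RRe_real// gtr0_real.
  have c0 : 0 < 2 * `|c| + 1 by rewrite ltr_wpDl// mulr_ge0.
  have [k hk] := rate_small (divr_gt0 Re0 c0).
  exists (u k), k => // l /= kl; rewrite -ball_normE /= normr_sn eE ltcR.
  rewrite (le_lt_trans (hu _ _))//.
  have lk : rate R l <= rate R k by rewrite lef_pV2 ?posrE ?ltr0n// ler_nat ltnS.
  have r0 := rate_gt0 R l; have r1 := rate_gt0 R k.
  apply: (@le_lt_trans _ _ (`|c| * (rate R k + rate R l))).
    by rewrite ler_wpM2r ?ler_norm// addr_ge0// ltW.
  move: hk; rewrite ltr_pdivlMr// => hk.
  have := ler_wpM2l (normr_ge0 c) lk; lra.
move=> /cvg_ex[x hx]; exists x => k; apply/ler_addgt0Pr => e e0.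
have /hx/= [m _ hm] : nbhs x [set y | n (x - y) < e / 2]%classic.
  by apply/nbhs_snP; exists (e / 2); rewrite ?divr_gt0.
apply: (@ler_addrate _ _ _ c) => l0.
pose l := maxn m l0.
have xl : n (x - u l) < e / 2 by apply: hm; rewrite /= leq_maxl.
rewrite -[x](subrK (u l)) -addrA (le_trans (snD hB _ _))//.
have c0 : 0 <= c.
  have h := le_trans (sn_ge0 _ _) (hu 0 0); have r0 := rate_gt0 R 0.
  by rewrite -(@pmulr_lge0 _ (rate R 0 + rate R 0)) ?addr_gt0.
have ll : rate R l <= rate R l0.
  by rewrite lef_pV2 ?posrE ?ltr0n// ler_nat ltnS leq_maxr.
have := ler_wpM2l c0 ll; have := hu l k; lra.
Qed.

(** ** Extending isometries from a dense image *)
Section DenseIsometry.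
Variables (V : lmodType R[i]) (i : {linear V -> H}) (t : {linear V -> V}).
Hypothesis i_dense : forall x e, 0 < e -> exists f, n (x - i f) <= e.
Hypothesis t_isom : forall f, n (i (t f)) = n (i f).

(** [T x] is the limit of [i (t f)] as [i f] tends to [x].  It satisfies
    [n (T x - i (t f)) <= n (x - i f)] for all [f], which gives linearity and
    isometry by density. *)
Lemma isometry_extend : exists T : {linear H -> H},
  (forall f, T (i f) = i (t f)) /\ (forall x, n (T x) = n x).
Proof.
have ext x : exists y, forall f, n (y - i (t f)) <= n (x - i f).
  have /choice[F hF] k := i_dense x (rate_gt0 R k).
  have bd f f' : n (i (t f) - i (t f')) <= n (x - i f) + n (x - i f').
    by rewrite -!raddfB t_isom raddfB (le_trans (sn_triangle hB x _ _))//= !(snBC hB x).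
  have [y hy] : exists y, forall k, n (y - i (t (F k))) <= 1 * rate R k.
    apply: hilbert_complete => k l.
    by rewrite mul1r (le_trans (bd _ _))// lerD.
  exists y => f; apply: (@ler_addrate _ _ _ 2) => k.
  rewrite -[y](subrK (i (t (F k)))) -addrA (le_trans (snD hB _ _))//.
  have := hy k; have := hF k; have := bd (F k) f; lra.
have [T hT] := choice ext.
have Tlin : linear T.
  move=> a x y; apply/eqP; rewrite -subr_eq0; apply/eqP.
  apply: (@sn_small_eq0 _ (2 * (cabs a + 1))) => e e0.
  have [f hf] := i_dense x e0; have [f' hf'] := i_dense y e0.
  rewrite (le_trans (sn_triangle hB (i (t (a *: f + f'))) _ _))//.
  have h1 := hT (a *: x + y) (a *: f + f').
  have h2 := sn_lincomb hB a x y (i f) (i f').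
  have h3 := sn_lincomb hB a (T x) (T y) (i (t f)) (i (t f')).
  have e1 : i (a *: f + f') = a *: i f + i f' by rewrite linearP.
  have e2 : i (t (a *: f + f')) = a *: i (t f) + i (t f') by rewrite !linearP.
  rewrite e1 e2 in h1 *.
  have := ler_wpM2l (cabs_ge0 a) hf.
  have := ler_wpM2l (cabs_ge0 a) (hT x f); have := hT y f'; lra.
pose T' : {linear H -> H} := HB.pack T (GRing.isLinear.Build _ _ _ _ T Tlin).
exists T'; split=> /= [f|x].
  apply/eqP; rewrite -subr_eq0 -sn_eq0 eq_le sn_ge0 andbT.
  by rewrite (le_trans (hT _ f))// subrr (sn0 hB).
apply/eqP; rewrite -subr_eq0 -normr_le0; apply/ler_addgt0Pr => e e0.
have [f hf] := i_dense x (divr_gt0 e0 (ltr0n _ 2)).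
have h1 := sn_dist hB (T x) (i (t f)); have h2 := sn_dist hB (i f) x.
have h3 := hT x f; rewrite add0r -(subrK (n (i f)) (n (T x))) -addrA.
rewrite (le_trans (ler_normD _ _))//; rewrite t_isom in h1.
rewrite (snBC hB) in h2; lra.
Qed.

End DenseIsometry.
Section Isometry.
Variable T : {linear H -> H}.
Hypothesis T_isom : forall x, n (T x) = n x.

(** Polarization. *)
Lemma isometry_ip x y : ip (T x) (T y) = ip x y.
Proof.
have re x' y' : complex.Re (ip (T x') (T y')) = complex.Re (ip x' y').
  have := sn_sqrD hB x' y'; have := sn_sqrD hB (T x') (T y').
  rewrite -linearD !T_isom => -> h.
  by apply: (@mulfI _ 2); rewrite ?pnatr_eq0//; apply: addrI h.
have im (w : R[i]) : complex.Im w = - complex.Re ('i%C * w) by rewrite mulrC ReiNIm opprK.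
apply/eqP; rewrite eq_complex re eqxx /= !im -!(psdZl hB) -linearZ/= re.
exact: eqxx.
Qed.

(** The range of an isometry on a complete space is closed. *)
Lemma isometry_onto :
  (forall y e, 0 < e -> exists x, n (y - T x) <= e) -> forall y, exists x, T x = y.
Proof.
move=> dT y; have /choice[x hx] k := dT y _ (rate_gt0 R k).
have [k l|z hz] := @hilbert_complete x 1.
  by rewrite -T_isom raddfB mul1r (le_trans (sn_triangle hB y _ _))// !(snBC hB _ y) lerD ?hx.
exists z; apply/eqP; rewrite -subr_eq0; apply/eqP.
apply: (@sn_small_eq0 _ 2) => e e0; have [k hk] := rate_small e0.
rewrite (le_trans (sn_triangle hB (T (x k)) _ _))//.
have := hx k; have := hz k; rewrite -(T_isom (z - x k)) raddfB; lra.
Qed.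

Lemma isometry_continuous : continuous T.
Proof.
move=> x A /nbhs_snP[e e0 he]; apply/nbhs_snP; exists e => // y hy.
by apply: he; rewrite -raddfB T_isom.
Qed.

Lemma isometry_unitary : (forall y, exists x, T x = y) -> unitary ip T.
Proof.
move=> onto; split; first exact: isometry_continuous.
have [S hS] := choice onto.
have inj x y : T x = T y -> x = y.
  move=> h; apply/eqP; rewrite -subr_eq0 -sn_eq0 -T_isom raddfB/= h subrr.
  by rewrite (sn0 hB).
have Slin : linear S by move=> a x y; apply: inj; rewrite linearP !hS.
pose S' : {linear H -> H} := HB.pack S (GRing.isLinear.Build _ _ _ _ S Slin).
exists S'; split => [x y|x|y].
- by rewrite -{1}(hS y) isometry_ip.
- by apply: inj; exact: hS.
- exact: hS.
Qed.

End Isometry.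

(** ** The weak topology *)
Lemma linear_form_bounded (F : dual H) :
  exists2 M, 0 < M & forall x, cabs (sval F x) <= M * n x.
Proof.
case: F => F /= Fc.
have [e e0 he] : exists2 e, 0 < e & forall y, n (0 - y) < e -> cabs (F y) < 1.
  have h : nbhs (F 0 : R[i]^o) [set z | cabs z < 1].
    apply/nbhs_radiusP; exists 1 => // z; rewrite linear0 sub0r normrN.
    by rewrite normr_cabs ltcR.
  by have /nbhs_snP := Fc 0 _ h.
exists (2 / e) => [|x]; first by rewrite divr_gt0.
have [->|x0] := eqVneq x 0; first by rewrite linear0 cabs0 (sn0 hB) mulr0.
have nx : 0 < n x by rewrite lt_def sn_eq0 x0 sn_ge0.
pose r := e / (2 * n x).
have r0 : 0 < r by rewrite divr_gt0 ?mulr_gt0.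
have := he (r%:C *: x); rewrite sub0r (snN hB) (snZ hB) linearZ cabsM.
rewrite cabs_real gtr0_norm//.
have -> : r * n x = e / 2 by rewrite /r; field; rewrite gt_eqF.
have h2 : e / 2 < e by lra.
move=> /(_ h2); rewrite mulrC -ltr_pdivlMr// div1r => h; apply: le_trans (ltW h) _.
by rewrite /r le_eqVlt; apply/orP; left; apply/eqP; field; rewrite !gt_eqF.
Qed.

Definition ipl g : H -> R[i] := fun x => ip x g.

Lemma ipl_dual g : exists F : dual H, forall x, sval F x = ip x g.
Proof.
have lin : scalar (ipl g) by move=> a x y; rewrite /ipl (psd_linear hB).
pose F : {scalar H} := HB.pack (ipl g) (GRing.isLinear.Build _ _ _ _ (ipl g) lin).
have cF : continuous (F : H -> R[i]^o).
  move=> x A /nbhs_radiusP[e e0 he]; apply/nbhs_snP.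
  have c0 : 0 < n g + 1 by rewrite ltr_wpDl ?sn_ge0.
  exists (e / (n g + 1)) => [|y hy]; first by rewrite divr_gt0.
  apply: he; rewrite -raddfB normr_cabs ltcR.
  rewrite (le_lt_trans (psd_CS hB _ _))//.
  move: hy; rewrite ltr_pdivlMr// => /(le_lt_trans _); apply.
  by rewrite ler_wpM2l ?sn_ge0// lerDl.
by exists (exist _ F cF).
Qed.

Lemma weak_cvg_ip (u : nat -> H) l g e : 0 < e ->
  u k @[k --> \oo] --> (l : weak_topology H) ->
  exists N, forall k, (N <= k)%N -> cabs (ip (u k - l) g) < e.
Proof.
move=> e0 /cvg_sup hu; have [F hF] := ipl_dual g.
have h : nbhs (sval F l : R[i]^o) [set z | cabs (z - sval F l) < e].
  apply/nbhs_radiusP; exists e => // z; rewrite normr_cabs ltcR.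
  by rewrite cabsB.
have := @initial_continuous H R[i]^o (sval F) l _ h.
move=> /(hu F)[N _ hN]; exists N => k /hN /=.
by rewrite (psdBl hB) !hF.
Qed.

(** Move from [x] by a multiple [w] of [v], in the better of the two directions:
    [|<v, x + w>| + |<v, x - w>| >= 2 |<v, w>|]. *)
Lemma gliding_step x v c : 0 <= c -> v != 0 ->
  exists2 y, n (y - x) = c & c * n v <= cabs (ip v y).
Proof.
move=> c0 v0; have nv : 0 < n v by rewrite lt_def sn_eq0 v0 sn_ge0.
pose w := (c / n v)%:C *: v.
have nw : n w = c.
  rewrite (snZ hB) cabs_real ger0_norm ?divfK ?gt_eqF//.
  by rewrite divr_ge0// sn_ge0.
have vw : cabs (ip v w) = c * n v.
  rewrite (psdZr hB) (psd_diag hB) cabsM cabs_conj !cabs_real !ger0_norm ?sqr_ge0//.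
    by rewrite expr2 mulrA divfK// gt_eqF.
  by rewrite divr_ge0// sn_ge0.
have [h|h] := leP (c * n v) (cabs (ip v (x + w))).
  by exists (x + w) => //; rewrite addrAC subrr add0r.
exists (x - w); first by rewrite addrAC subrr add0r (snN hB).
have : 2 * cabs (ip v w) <= cabs (ip v (x + w)) + cabs (ip v (x - w)).
  have -> : 2 * cabs (ip v w) = cabs (ip v (x + w) - ip v (x - w)).
    rewrite -[2 in LHS](cabs_nat R) -cabsM; congr cabs.
    by rewrite (psdDr hB) (psdBr hB); ring.
  by rewrite (le_trans (cabsD _ _))// cabsN.
by rewrite vw; lra.
Qed.

(** The uniform boundedness principle, by a gliding hump.  If the norms of the
    [v k] are unbounded, steps of length [4^-j] lead to a point [x] with
    [<v (K j), x>] unbounded: the [j]-th step makes [<v (K j), X j.+1>] large, and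
    all later steps together have only a third of its length. *)
Lemma weakly_bounded_bounded (v : nat -> H) :
  (forall g, exists M, forall k, cabs (ip (v k) g) <= M) ->
  exists M, forall k, n (v k) <= M.
Proof.
move=> wb; apply: contrapT => nb.
have big M : exists k, M < n (v k).
  apply: contrapT => h; apply: nb; exists M => k; rewrite leNgt; apply/negP => hk.
  by apply: h; exists k.
pose r j : R := 4^-1 ^+ j.
have r0 j : 0 < r j by rewrite exprn_gt0// invr_gt0.
have rS j : r j.+1 = r j / 4 by rewrite /r exprS mulrC.
have /choice[K hK] j := big (j%:R / r j).
have vK0 j : v (K j) != 0.
  rewrite -sn_eq0 gt_eqF// (le_lt_trans _ (hK j))// divr_ge0// ltW//.
have /choice[stp hstp] (jx : nat * H) :
    exists y, n (y - jx.2) = r jx.1 /\ r jx.1 * n (v (K jx.1)) <= cabs (ip (v (K jx.1)) y).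
  by have [y h1 h2] := gliding_step jx.2 (ltW (r0 jx.1)) (vK0 jx.1); exists y.
pose fix X j := if j is j'.+1 then stp (j', X j') else 0.
have XS j : n (X j.+1 - X j) = r j by have [] := hstp (j, X j).
have Xv j : r j * n (v (K j)) <= cabs (ip (v (K j)) (X j.+1)).
  by have [] := hstp (j, X j).
have Xd j d : n (X (j + d)%N - X j) <= 4 / 3 * (r j - r (j + d)%N).
  elim: d => [|d IH]; first by rewrite addn0 !subrr (sn0 hB) mulr0.
  rewrite addnS -(subrK (X (j + d)%N) (X (j + d).+1)) -addrA.
  rewrite (le_trans (snD hB _ _))// XS rS; lra.
have Xd' j l : (j <= l)%N -> n (X l - X j) <= 4 / 3 * r j.
  move=> jl; rewrite -(subnKC jl); have := Xd j (l - j)%N.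
  have := r0 (j + (l - j))%N; lra.
have rr j : r j <= rate R j.
  elim: j => [|j IH]; first by rewrite /r /rate expr0 invr1.
  rewrite rS; apply: (@le_trans _ _ (rate R j / 2)); first by have := r0 j; lra.
  rewrite /rate -invfM lef_pV2 ?posrE ?mulr_gt0 ?ltr0n// -natrM ler_nat; lia.
have [k l|x hx] := @hilbert_complete X (4 / 3).
  have [kl|/ltnW lk] := leqP k l.
    rewrite (snBC hB); have := Xd' _ _ kl; have := rr k; have := rate_gt0 R l; lra.
  have := Xd' _ _ lk; have := rr l; have := rate_gt0 R k; lra.
(* the later steps add up to at most (1 + 1/4 + 1/16 + ...) r j *)
have xX j : n (x - X j) <= 4 / 3 * r j.
  apply: (@ler_addrate _ _ _ (4 / 3)) => l.
  rewrite (le_trans (sn_triangle hB (X (maxn j l)) _ _))//.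
  have h1 := hx (maxn j l); have h2 := Xd' _ _ (leq_maxl j l).
  have h3 : rate R (maxn j l) <= rate R l.
    by rewrite lef_pV2 ?posrE ?ltr0n// ler_nat ltnS leq_maxr.
  by rewrite [n (X j - _)](snBC hB); lra.
have [M hM] := wb x.
(* |<v (K j), x>| >= (1 - 1/3) r j n (v (K j)) > 2/3 j *)
pose j := (Num.truncn (3 / 2 * M)).+1.
have jM : 3 / 2 * M < j%:R by exact: truncnS_gt.
have h1 := hM (K j); have h2 := Xv j.
have h3 : cabs (ip (v (K j)) (X j.+1)) <= cabs (ip (v (K j)) x) + r j / 3 * n (v (K j)).
  rewrite -{1}[X j.+1](subrK x) (psdDr hB) addrC (le_trans (cabsD _ _))// lerD2l.
  rewrite (le_trans (psd_CS hB _ _))// mulrC ler_wpM2r ?sn_ge0// (snBC hB).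
  by rewrite (le_trans (xX _))// rS; lra.
have h4 : j%:R < r j * n (v (K j)) by rewrite mulrC -ltr_pdivrMr.
lra.
Qed.

Lemma eventually_below (P : nat -> nat -> Prop) K :
  (forall k, exists N, forall m, (N <= m)%N -> P k m) ->
  exists N, forall k m, (k < K)%N -> (N <= m)%N -> P k m.
Proof.
move=> hP; elim: K => [|K [N hN]]; first by exists 0%N.
have [N' hN'] := hP K; exists (maxn N N') => k m.
rewrite ltnS leq_eqVlt geq_max => /predU1P[->|kK] /andP[Nm N'm].
  exact: hN'.
exact: hN.
Qed.

(** * Projective orbits of a weakly null isometry *)
Section ProjectiveOrbits.
Variable T : {linear H -> H}.
Hypothesis T_isom : forall x, n (T x) = n x.
Hypothesis T_null : forall x y e, 0 < e ->
  exists N, forall m, (N <= m)%N -> cabs (ip (iter m T x) y) < e.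

Lemma sn_iter m x : n (iter m T x) = n x.
Proof. by elim: m => //= m; rewrite T_isom. Qed.

(** If [l] is not in the orbit, every exponent is eventually avoided: for
    [v = T^k x], the component [g] of [l] orthogonal to [v] satisfies
    [<l, g> = <g, g> > 0] and [<v, g> = 0].  Hence the exponents tend to infinity;
    as the coefficients are bounded, [u m] tends weakly to 0. *)
Lemma weak_limit_proj_orbit x (u : nat -> H) l :
  (forall k, proj_orbit T x (u k)) ->
  (forall g e, 0 < e ->
    exists N, forall k, (N <= k)%N -> cabs (ip (u k - l) g) < e) ->
  proj_orbit T x l.
Proof.
move=> hu wc; apply: contrapT => lorb.
have /choice[K /choice[a hK]] k : exists m, exists c : R[i], u k = c *: iter m T x.
  by have [m [c h]] := hu k; exists m, c.
have avoid k : exists N, forall m, (N <= m)%N -> K m <> k.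
  (* if v = 0 then d = 0, by the convention for division by zero, and g = l *)
  pose v := iter k T x; pose d := ip l v / ip v v; pose g := l - d *: v.
  have gv : ip g v = 0.
    rewrite (psdBl hB) (psdZl hB) /d.
    have [->|v0] := eqVneq v 0; first by rewrite !(psd0r hB) mulr0 subrr.
    by rewrite divfK ?subrr// gt_eqF// dnorm_gt0.
  have vg : ip v g = 0 by rewrite (psd_herm hB g v) gv conjC0.
  have g0 : g != 0.
    apply/eqP => g0; apply: lorb; exists k, d; apply/eqP.
    by rewrite -subr_eq0; apply/eqP.
  have lg : ip l g = ip g g.
    by rewrite -[X in ip X g](subrK (d *: v) l) (psdDl hB) (psdZl hB) vg mulr0 addr0.
  have lg0 : 0 < cabs (ip l g).
    by rewrite lt_def cabs_eq0 cabs_ge0 andbT lg gt_eqF// dnorm_gt0.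
  have [N hN] := wc g _ lg0; exists N => m /hN + Km.
  by rewrite hK Km (psdBl hB) (psdZl hB) vg mulr0 sub0r cabsN ltxx.
have avoid_below k : exists N, forall m, (N <= m)%N -> (k <= K m)%N.
  have [N hN] := eventually_below k avoid; exists N => m Nm.
  by rewrite leqNgt; apply/negP => h; exact: hN h Nm _.
have [M hM] : exists M, forall k, n (u k) <= M.
  apply: weakly_bounded_bounded => g; have [N hN] := wc g 1 ltr01.
  pose s k := cabs (ip (u k) g).
  exists (cabs (ip l g) + 1 + \sum_(j < N) s j) => k.
  have s0 : 0 <= \sum_(j < N) s j by apply: sumr_ge0 => j _; exact: cabs_ge0.
  have [kN|/hN] := ltnP k N.
    rewrite (bigD1 (Ordinal kN))//= -/(s k).
    have : 0 <= \sum_(j < N | j != Ordinal kN) s j.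
      by apply: sumr_ge0 => j _; exact: cabs_ge0.
    have := cabs_ge0 (ip l g); lra.
  rewrite (psdBl hB) => h.
  have := cabsD (ip (u k) g - ip l g) (ip l g); rewrite subrK; lra.
apply: lorb; exists 0%N, 0; rewrite scale0r.
apply/eqP; rewrite -(dnorm_eq0 ip); apply/eqP.
apply: (@cabs_small_eq0 _ _ 2) => e e0.
pose c := M / n x; have M0 : 0 <= M by exact: le_trans (sn_ge0 _ _) (hM 0%N).
have c0 : 0 <= c by rewrite divr_ge0 ?sn_ge0.
have c1 : 0 < c + 1 by rewrite ltr_wpDl.
have [N hN] := wc l _ e0; have [k hk] := T_null x l (divr_gt0 e0 c1).
have [N' hN'] := avoid_below k; pose m := maxn N N'.
have h1 := hN m (leq_maxl _ _).
have h2 : cabs (ip (u m) l) <= e.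
  have hm := hk _ (hN' m (leq_maxr _ _)).
  rewrite hK (psdZl hB) cabsM; have := hM m; rewrite hK (snZ hB) sn_iter.
  have [x0|x0] := eqVneq (n x) 0 => [_|].
    rewrite (le_trans (ler_wpM2l (cabs_ge0 _) (psd_CS hB _ _)))//.
    by rewrite sn_iter x0 mul0r mulr0 ltW.
  rewrite -ler_pdivlMr; last by rewrite lt_def x0 sn_ge0.
  rewrite -/c => ac; apply: (@le_trans _ _ ((c + 1) * (e / (c + 1)))); last first.
    by rewrite mulrC divfK// gt_eqF.
  by rewrite ler_pM ?cabs_ge0// ?(ltW hm)// (le_trans ac)// lerDl.
have -> : ip l l = ip (u m) l - ip (u m - l) l by rewrite (psdBl hB); ring.
by rewrite (le_trans (cabsD _ _))// cabsN; lra.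
Qed.

Lemma proj_orbit_seq_closed x :
  @seq_closed (weak_topology H) (proj_orbit T x).
Proof.
move=> u l hu ul; apply: (@weak_limit_proj_orbit x u l hu) => g e e0.
exact: weak_cvg_ip.
Qed.

(** If every [x + t T x] with [t] real lay in the orbit, then the exponent would
    be an injective function of [t], since two different values of [t] on the same
    line make [x] and [T x] proportional.  But [R] is uncountable. *)
Lemma proj_orbit_neqT (e1 : H) x : e1 != 0 -> exists y, ~ proj_orbit T x y.
Proof.
move=> e10; apply: contrapT => hall.
have all y : proj_orbit T x y by apply: contrapT => hy; apply: hall; exists y.
have x0 : x != 0.
  apply: contraNneq e10 => x0; have [m [c ->]] := all e1.
  by rewrite -sn_eq0 (snZ hB) sn_iter x0 (sn0 hB) mulr0.
have indep (c : R[i]) : T x <> c *: x.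
  move=> Tx; have it m : iter m T x = c ^+ m *: x.
    elim: m => [|m IH]; first by rewrite expr0 scale1r.
    by rewrite iterS IH linearZ/= Tx scalerA exprSr.
  have xx : 0 < cabs (ip x x) by rewrite lt_def cabs_eq0 cabs_ge0 andbT gt_eqF// dnorm_gt0.
  have [N hN] := T_null x x xx; have := hN N (leqnn N).
  rewrite it (psdZl hB) cabsM -[ltRHS]mul1r.
  have -> : cabs (c ^+ N) = 1; last by rewrite ltxx.
  have := sn_iter N x; rewrite it (snZ hB) -[RHS]mul1r.
  by apply: mulIf; rewrite sn_eq0.
have /choice[k /choice[c hk]] (t : R) :
    exists m, exists c : R[i], x + t%:C *: T x = c *: iter m T x.
  by have [m [c h]] := all (x + t%:C *: T x); exists m, c.
have kinj : injective k.
  move=> s t kst; apply/eqP; rewrite -subr_eq0; apply/negPn/negP => st.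
  have := hk s; have := hk t; rewrite kst; set v := iter _ T x => ht hs.
  have st' : s%:C - t%:C != 0 :> R[i].
    by rewrite -rmorphB (inj_eq (@complexI R) _ 0).
  pose al := (c s - c t) / (s%:C - t%:C).
  have Tv : T x = al *: v.
    apply: (@scalerI _ _ (s%:C - t%:C)) => //.
    rewrite scalerA mulrC divfK// [RHS]scalerBl -hs -ht opprD addrACA subrr add0r.
    by rewrite scalerBl.
  have xv : x = (c s - s%:C * al) *: v.
    by rewrite scalerBl -hs -scalerA -Tv addrK.
  apply: (indep (al / (c s - s%:C * al))); rewrite [X in _ *: X]xv Tv scalerA.
  rewrite divfK//; apply: contra_neq x0 => b0.
  by rewrite xv b0 scale0r.
have cR : countable [set: R] by apply/countable_injP; exists k => s t _ _; exact: kinj.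
have := countable_lebesgue_measure0 cR.
have := @lebesgue_measure_itv R `]-oo, +oo[.
by rewrite set_itvE => -> /=.
Qed.

End ProjectiveOrbits.
(** * A criterion for weakly dense projective orbits *)
Lemma weak_nbhs (y : H) (O : set (weak_topology H)) :
  nbhs (y : weak_topology H) O ->
  exists (s : seq {classic dual H}) e, 0 < e /\
    forall z : H, (forall F, F \in s -> cabs (sval F z - sval F y) < e) -> O z.
Proof.
pose G : set_system H := [set A | exists (s : seq {classic dual H}) e, 0 < e /\
    forall z : H, (forall F, F \in s -> cabs (sval F z - sval F y) < e) -> A z].
suff : G --> (y : weak_topology H) by apply.
have GF : Filter G.
  split.
  - by exists [::], 1; split.
  - move=> A A' [s [e [e0 hs]]] [s' [e' [e0' hs']]].
    exists (s ++ s'), (Num.min e e'); split; first by rewrite lt_min e0.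
    move=> z hz; split.
    + by apply: hs => F Fs; have := hz F; rewrite mem_cat Fs lt_min => /(_ isT)/andP[].
    + by apply: hs' => F Fs; have := hz F; rewrite mem_cat Fs orbT lt_min => /(_ isT)/andP[].
  - move=> A A' AA' [s [e [e0 hs]]]; exists s, e; split => // z hz.
    by apply/AA'/hs.
apply/cvg_sup => F A /= [_ [[B oB <-] By BA]].
have /nbhs_radiusP[e e0 he] : nbhs (sval F y : R[i]^o) B by exact: open_nbhs_nbhs.
exists [:: F : {classic dual H}], e; split => // z hz; apply: BA; apply: he.
by rewrite normr_cabs ltcR cabsB; apply: hz; rewrite mem_seq1.
Qed.

(** Evaluate [F] at the sum of the [conj (F (u k)) u k]. *)
Lemma bessel_form (F : dual H) (u : nat -> H) M m :
  (forall j k, j != k -> ip (u j) (u k) = 0) -> (forall k, n (u k) <= 2) ->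
  0 <= M -> (forall x, cabs (sval F x) <= M * n x) ->
  \sum_(0 <= k < m) cabs (sval F (u k)) ^+ 2 <= 4 * M ^+ 2.
Proof.
move=> ou nu M0 FM.
set S := \sum_(_ <= _ < _) _.
have S0 : 0 <= S by apply: sumr_ge0 => k _; exact: sqr_ge0.
(* F w = S while n w ^ 2 <= 4 S *)
pose w := \sum_(0 <= k < m) (sval F (u k))^* *: u k.
have Fw : sval F w = S%:C.
  rewrite /w linear_sum rmorph_sum; apply: eq_bigr => k _.
  by rewrite linearZ/= mulrC mul_conj.
have nw : n w ^+ 2 <= 4 * S.
  rewrite /w (sn_sqr_orthogonal hB)// ?iota_uniq// mulr_sumr ler_sum// => k _.
  rewrite cabs_conj mulrC ler_wpM2r ?sqr_ge0// (_ : 4 = 2 ^+ 2); last by ring.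
  by rewrite ler_pXn2r ?nnegrE ?sn_ge0.
have := FM w; rewrite Fw cabs_real ger0_norm// => h.
have h2 : S ^+ 2 <= 4 * M ^+ 2 * S.
  apply: (@le_trans _ _ ((M * n w) ^+ 2)).
    by rewrite ler_pXn2r ?nnegrE ?mulr_ge0 ?sn_ge0.
  by have := ler_wpM2l (sqr_ge0 M) nw; rewrite exprMn; lra.
have [->|Sn0] := eqVneq S 0; first by rewrite mulr_ge0 ?sqr_ge0.
by rewrite -(@ler_pM2r _ S) -?expr2// lt_def Sn0.
Qed.

(** For finitely many functionals [F] the numbers [|F (u k)| ^ 2] are summable by
    Bessel's inequality, whereas the [a k ^ 2] are not.  So [F (u k) / a k] is
    small for all these [F] at some [k], and then [(a k)^-1 T^(N k) x] is weakly
    close to [p]. *)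
Lemma weakly_dense_orbit (T : {linear H -> H}) x :
  (forall y e, 0 < e ->
    exists p (N : nat -> nat) (a : nat -> R) (u : nat -> H),
      [/\ n (y - p) <= e, forall k, iter (N k) T x = (a k)%:C *: p + u k,
          forall j k, j != k -> ip (u j) (u k) = 0, forall k, n (u k) <= 2 &
          forall M, exists m, M < \sum_(0 <= k < m) a k ^+ 2]) ->
  @dense (weak_topology H) (proj_orbit T x).
Proof.
move=> crit O [y Oy] oO.
have [s [e [e0 hs]]] : exists (s : seq {classic dual H}) e, 0 < e /\
    forall z : H, (forall F, F \in s -> cabs (sval F z - sval F y) < e) -> O z.
  by apply: weak_nbhs; exact: open_nbhs_nbhs.
have /choice[M hM] (F : dual H) :
    exists M, 0 < M /\ forall x, cabs (sval F x) <= M * n x.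
  by have [M M0 h] := linear_form_bounded F; exists M.
pose M1 := 1 + \sum_(F <- s) M F.
have M10 : 0 < M1.
  by rewrite ltr_pwDl// sumr_ge0// => F _; rewrite ltW//; case: (hM F).
have M1F F z : F \in s -> cabs (sval F z) <= M1 * n z.
  move=> Fs; have [_ h] := hM F; apply: le_trans (h z) _.
  rewrite ler_wpM2r ?sn_ge0// /M1 (big_rem F)//= addrCA lerDl addr_ge0//.
  by apply: sumr_ge0 => G _; rewrite ltW//; case: (hM G).
have d0 : 0 < e / (2 * M1) by rewrite divr_gt0// mulr_gt0.
have [p [N [a [u [yp it ou nu sa]]]]] := crit y _ d0.
have [k hk] : exists k,
    \sum_(F <- s) cabs (sval F (u k)) ^+ 2 < (e / 2) ^+ 2 * a k ^+ 2.
  apply: contrapT => hno.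
  pose L := (size s)%:R * (4 * M1 ^+ 2).
  have [m hm] := sa (L / (e / 2) ^+ 2).
  have e22 : 0 < (e / 2) ^+ 2 by rewrite exprn_gt0// divr_gt0.
  move: hm; rewrite ltr_pdivrMr// mulr_suml ltNge => /negP; apply.
  apply: (@le_trans _ _ (\sum_(0 <= k < m) \sum_(F <- s) cabs (sval F (u k)) ^+ 2)).
    apply: ler_sum => k _; rewrite leNgt mulrC; apply/negP => h; apply: hno.
    by exists k.
  rewrite exchange_big/= /L -sum1_size natr_sum mulr_suml.
  rewrite big_seq [leRHS]big_seq; apply: ler_sum => F Fs; rewrite mul1r.
  by apply: bessel_form => // [|z]; [exact: ltW|exact: M1F].
have a0 : a k != 0.
  apply/eqP => a0; move: hk; rewrite a0 expr0n mulr0 ltNge => /negP; apply.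
  by apply: sumr_ge0 => F _; exact: sqr_ge0.
have aC : (a k)%:C != 0 :> R[i] by rewrite (inj_eq (@complexI R) _ 0).
exists ((a k)^-1%:C *: iter (N k) T x); split; last by exists (N k), (a k)^-1%:C.
apply: hs => F Fs.
have -> : (a k)^-1%:C *: iter (N k) T x = p + (a k)^-1%:C *: u k.
  by rewrite it scalerDr scalerA fmorphV mulVf// scale1r.
rewrite linearD linearZ/= addrAC -linearB/=.
have h1 : cabs (sval F (p - y)) <= e / 2.
  rewrite (le_trans (M1F _ _ Fs))// (snBC hB).
  rewrite (le_trans (ler_wpM2l (ltW M10) yp))// le_eqVlt; apply/orP; left.
  by apply/eqP; field; rewrite gt_eqF.
have h2 : cabs ((a k)^-1%:C * sval F (u k)) < e / 2.
  rewrite cabsM cabs_real normfV mulrC ltr_pdivrMr ?normr_gt0//.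
  rewrite -(@ltr_pXn2r _ 2%N) ?nnegrE ?cabs_ge0 ?mulr_ge0 ?divr_ge0 ?(ltW e0)//.
  rewrite exprMn real_normK ?num_real//; apply: le_lt_trans hk.
  rewrite (big_rem F)//= lerDl; apply: sumr_ge0 => G _; exact: sqr_ge0.
rewrite (le_lt_trans (cabsD _ _))//; lra.
Qed.

End HilbertSpace.

(** * Null sequences and divergent series *)
Section NullSequences.
Variable R : realType.
Implicit Types (s t : nat -> R[i]) (e : R).

Definition nullseq s :=
  forall e, 0 < e -> exists N, forall m, (N <= m)%N -> cabs (s m) < e.

Lemma nullseqD s t : nullseq s -> nullseq t -> nullseq (fun m => s m + t m).
Proof.
move=> hs ht e e0; have e2 : 0 < e / 2 by rewrite divr_gt0.
have [N hN] := hs _ e2; have [N' hN'] := ht _ e2.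
exists (maxn N N') => m; rewrite geq_max => /andP[/hN h1 /hN' h2].
by rewrite (le_lt_trans (cabsD _ _))//; lra.
Qed.

Lemma nullseqZ a s : nullseq s -> nullseq (fun m => a * s m).
Proof.
move=> hs e e0; have a1 : 0 < cabs a + 1 by rewrite ltr_wpDl ?cabs_ge0.
have [N hN] := hs _ (divr_gt0 e0 a1); exists N => m /hN.
rewrite ltr_pdivlMr// cabsM => h; apply: le_lt_trans h.
by rewrite mulrC ler_wpM2l ?cabs_ge0// lerDl.
Qed.

Lemma nullseq_sum r (s : 'I_r -> nat -> R[i]) :
  (forall i, nullseq (s i)) -> nullseq (fun m => \sum_i s i m).
Proof.
move=> hs; suff: forall l, nullseq (fun m => \sum_(i <- l) s i m) by apply.
elim=> [|i l IH]; first by move=> e e0; exists 0%N => m _; rewrite big_nil cabs0.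
move=> e e0; have [N hN] := nullseqD (hs i) IH e0.
by exists N => m /hN; rewrite big_cons.
Qed.

End NullSequences.

Section Harmonic.
Variable R : realType.

Lemma harmonic_unbounded (M : R) : exists m, M < \sum_(0 <= k < m) rate R k.
Proof.
apply: contrapT => h; apply: (@dvg_harmonic R).
apply: nondecreasing_is_cvgn.
  apply/nondecreasing_seqP => m; rewrite /series /= big_nat_recr//= lerDl.
  by rewrite invr_ge0.
exists M => _ [m _ <-]; rewrite leNgt; apply/negP => hm; apply: h.
by exists m.
Qed.

(** The [m]-th number [k] such that [k + 1] has 2-adic valuation [j]. *)
Definition slot (j m : nat) : nat := (2 ^ j * m.*2.+1).-1.

Lemma slotS j m : (slot j m).+1 = (2 ^ j * m.*2.+1)%N.
Proof. by rewrite /slot prednK// muln_gt0 expn_gt0. Qed.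

Lemma slot_logn j m : logn 2 (slot j m).+1 = j.
Proof.
rewrite slotS lognM ?expn_gt0// pfactorK// (lognE 2 _.+1) dvdn2 /= odd_double.
by rewrite addn0.
Qed.

Lemma slot_inj j : injective (slot j).
Proof.
move=> m m' /(congr1 succn); rewrite !slotS => /eqP.
by rewrite eqn_pmul2l ?expn_gt0// eqSS => /eqP/double_inj.
Qed.

Lemma slot_unbounded j (M : R) :
  exists m, M < \sum_(0 <= k < m) rate R (slot j k).
Proof.
have [m hm] := harmonic_unbounded (2 ^+ j.+1 * M).
exists m; rewrite -(@ltr_pM2l _ (2 ^+ j.+1)) ?exprn_gt0//.
apply: lt_le_trans hm _; rewrite mulr_sumr; apply: ler_sum => k _.
rewrite /rate slotS ler_pdivlMr ?ltr0n ?muln_gt0 ?expn_gt0//.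
rewrite mulrC ler_pdivrMr ?ltr0n//.
by rewrite -natrX -natrM ler_nat expnS -mulnA mulnCA leq_mul2l; lia.
Qed.

End Harmonic.

(** * Polynomials with Gaussian rational coefficients *)
Section GaussianRationals.
Variable R : realType.
Local Notation C := R[i].

Definition qpoly (s : seq (rat * rat)) : {poly C} :=
  Poly [seq (ratr q.1 +i* ratr q.2)%C | q <- s].

Lemma gauss_rat_dense (z : C) (e : R) : 0 < e ->
  exists q : rat * rat, cabs (z - (ratr q.1 +i* ratr q.2)%C) <= e.
Proof.
move=> e0.
have near x : exists q : rat, `|x - ratr q| <= e / 2.
  have [|q] := @rat_in_itvoo _ (x - e / 2) (x + e / 2); first by lra.
  by rewrite in_itv /= => /andP[h1 h2]; exists q; rewrite ler_norml; lra.
have [q hq] := near (complex.Re z); have [q' hq'] := near (complex.Im z).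
exists (q, q'); rewrite (le_trans (cabs_ReIm _))//= !raddfB /=; lra.
Qed.

Lemma l1_wide (f : {poly C}) m : (size f <= m)%N -> l1 f = \sum_(i < m) cabs f`_i.
Proof.
move=> fm; rewrite /l1 (big_ord_widen m (fun i => cabs f`_i)) // big_mkcond /=.
apply: eq_bigr => i _; case: ltnP => // h.
by rewrite nth_default// cabs0.
Qed.

Lemma qpoly_dense (f : {poly C}) (e : R) : 0 < e -> exists s, l1 (f - qpoly s) <= e.
Proof.
move=> e0; have d0 : 0 < e / (size f).+1%:R by rewrite divr_gt0.
have /choice[q hq] i := gauss_rat_dense f`_i d0.
pose s := mkseq q (size f); exists s.
have sq : (size (qpoly s) <= size f)%N.
  by rewrite (leq_trans (size_Poly _))// size_map size_mkseq.
rewrite (@l1_wide _ (size f)); last first.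
  by rewrite (leq_trans (size_polyD _ _))// geq_max leqnn size_polyN.
apply: (@le_trans _ _ (\sum_(i < size f) e / (size f).+1%:R)).
  apply: ler_sum => i _; rewrite coefB coef_Poly (nth_map (0, 0)) ?size_mkseq//.
  by rewrite nth_mkseq.
rewrite sumr_const card_ord -[leLHS]mulr_natr -mulrA ger_pMr//.
by rewrite mulrC ler_pdivrMr ?ltr0n// mul1r ler_nat.
Qed.

Definition enum_qpoly m : {poly C} := qpoly (odflt [::] (unpickle m)).

Lemma enum_qpolyK s : enum_qpoly (pickle s) = qpoly s.
Proof. by rewrite /enum_qpoly pickleK. Qed.

End GaussianRationals.

(** * Choice of the Riesz product *)
Section Construction.
Variable R : realType.
Local Notation C := R[i].

Definition riesz_poly (k : nat) : {poly C} := enum_qpoly R (logn 2 k.+1).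
(** The first factor ensures positivity of the form.  The second one tends to 0,
    but its square has a divergent sum along each [slot j]. *)
Definition riesz_amp (k : nat) : R := (2 * (1 + l1 (riesz_poly k)))^-1 * Num.sqrt (rate R k).

Lemma riesz_poly_slot j m : riesz_poly (slot j m) = enum_qpoly R j.
Proof. by rewrite /riesz_poly slot_logn. Qed.

Let l1p1 (f : {poly C}) : 0 < 1 + l1 f.
Proof. by rewrite ltr_pwDl// l1_ge0. Qed.

Lemma riesz_amp_ge0 k : 0 <= riesz_amp k.
Proof. by rewrite mulr_ge0 ?sqrtr_ge0// invr_ge0 mulr_ge0// ltW. Qed.

Lemma riesz_amp_l1_sqrt k : riesz_amp k * l1 (riesz_poly k) <= Num.sqrt (rate R k) / 2.
Proof.
rewrite /riesz_amp mulrAC [leRHS]mulrC ler_wpM2r ?sqrtr_ge0// mulrC.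
rewrite ler_pdivrMr ?mulr_gt0//; lra.
Qed.

Lemma riesz_amp_l1 k : riesz_amp k * l1 (riesz_poly k) <= 2^-1.
Proof.
rewrite (le_trans (riesz_amp_l1_sqrt k))// ler_piMl// -sqrtr1 ler_sqrt//.
by rewrite invf_le1 ?ltr0n// ler1n.
Qed.

Lemma riesz_amp_unbounded j (M : R) :
  exists m, M < \sum_(0 <= k < m) riesz_amp (slot j k) ^+ 2.
Proof.
pose c := (2 * (1 + l1 (enum_qpoly R j)))^-1.
have c0 : 0 < c ^+ 2 by rewrite exprn_gt0// invr_gt0 mulr_gt0.
have [m hm] := @slot_unbounded R j (M / c ^+ 2); exists m.
move: hm; rewrite ltr_pdivrMr// mulr_suml.
rewrite (eq_bigr (fun k => riesz_amp (slot j k) ^+ 2)) // => k _.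
by rewrite /riesz_amp riesz_poly_slot exprMn sqr_sqrtr ?(ltW (rate_gt0 _ _))// mulrC.
Qed.

Definition riesz_form := rlim riesz_poly riesz_amp.

Lemma riesz_form_psd : psd_form riesz_form.
Proof. exact: (rlim_psd riesz_amp_ge0 riesz_amp_l1). Qed.
Let hB := riesz_form_psd.

Lemma riesz_form_shift f g : riesz_form ('X * f) ('X * g) = riesz_form f g.
Proof. exact: (rlim_shift riesz_amp_ge0 riesz_amp_l1). Qed.

Lemma sn_le_l1 f : sn riesz_form f <= l1 f.
Proof.
have := sn_mul riesz_form_psd riesz_form_shift f 1; rewrite mulr1.
have -> : sn riesz_form 1 = 1; last by rewrite mulr1.
by rewrite /sn /riesz_form rlim11 ?sqrtr1//; [exact: riesz_amp_ge0|exact: riesz_amp_l1].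
Qed.

(** The [k]-th factor governs the coefficients between [width k] and
    [width k.+1], and its size tends to 0 with [k]. *)
Lemma riesz_corr_null : nullseq (fun m => riesz_form 'X^m 1).
Proof.
move=> e e0; have [K hK] := rate_small (exprn_gt0 2 e0).
have small k : (K <= k)%N -> riesz_amp k * l1 (riesz_poly k) < e.
  move=> Kk; rewrite (le_lt_trans (riesz_amp_l1_sqrt k))//.
  have h : Num.sqrt (rate R k) < e.
    rewrite -(@ltr_pXn2r _ 2%N) ?nnegrE ?sqrtr_ge0 ?(ltW e0)//.
    rewrite sqr_sqrtr ?(ltW (rate_gt0 _ _))//; apply: le_lt_trans hK.
    by rewrite lef_pV2 ?posrE ?ltr0n// ler_nat ltnS.
  have := sqrtr_ge0 (rate R k); lra.
exists (width riesz_poly K).+1 => m Km.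
have exw : exists k, (m <= width riesz_poly k)%N by exists m; exact: leq_width.
have [k mk kmin] := ex_minnP exw.
case: k mk kmin => [|k] mk kmin.
  have := leq_trans mk (width_mono riesz_poly (leq0n K)); lia.
have km : (width riesz_poly k < m)%N.
  by rewrite ltnNge; apply/negP => /kmin; rewrite ltnn.
apply: le_lt_trans (small k _); last first.
  rewrite leqNgt; apply/negP => kK.
  by have := leq_trans mk (width_mono riesz_poly kK); lia.
by apply: rlim_corr; rewrite ?km//; [exact: riesz_amp_ge0|exact: riesz_amp_l1].
Qed.

Lemma riesz_form_null f g : nullseq (fun m => riesz_form ('X^m * f) g).
Proof.
have mono a b : nullseq (fun m => riesz_form ('X^m * 'X^a) 'X^b).
  move=> e e0; have [N hN] := riesz_corr_null e0; exists (N + b)%N => m hm.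
  have -> : riesz_form ('X^m * 'X^a) 'X^b = riesz_form 'X^(m + a - b) 1.
    rewrite -[in RHS](shiftXn riesz_form_shift b) mulr1 -!exprD subnKC//; lia.
  by apply: hN; lia.
have -> : (fun m => riesz_form ('X^m * f) g) = (fun m =>
    \sum_(a < size f) \sum_(b < size g) (f`_a * (g`_b)^*) * riesz_form ('X^m * 'X^a) 'X^b).
  apply/funext => m; rewrite -{1}[f]coefK -{1}[g]coefK !poly_def mulr_sumr.
  rewrite (psd_suml hB); apply: eq_bigr => a _; rewrite (psd_sumr hB).
  by apply: eq_bigr => b _; rewrite -scalerAr (psdZl hB) (psdZr hB) mulrA.
by apply: nullseq_sum => a; apply: nullseq_sum => b; exact: nullseqZ.
Qed.

(** Singularity of the measure.  For the indices [k] with multiplier [1], the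
    average of the [riesz_amp k^-1 X^(freq k)] with weights [riesz_amp k ^ 2] is a
    multiple of [X], and its distance to [1] is at most [2 / sqrt S], where [S] is
    the divergent sum of the weights. *)
Lemma one_approx (e : R) : 0 < e -> exists g, sn riesz_form (1 - 'X * g) <= e.
Proof.
move=> e0; have [j p1] : exists j, enum_qpoly R j = 1.
  exists (pickle [:: (1, 0) : rat * rat]); rewrite enum_qpolyK; apply/polyP => i.
  by rewrite coef_Poly coef1 /= rmorph1 rmorph0; case: i => [|[|i]].
have [m hm] := riesz_amp_unbounded j (4 / e ^+ 2).
set S := \sum_(_ <= _ < _) _ in hm.
have S0 : 0 < S by apply: lt_trans hm; rewrite divr_gt0// exprn_gt0.
pose u k := resid riesz_poly riesz_amp (slot j k).
pose w := \sum_(0 <= k < m) (riesz_amp (slot j k))%:C *: u k.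
have ou k l : k != l -> riesz_form (u k) (u l) = 0.
  move=> kl; apply: (resid_orthogonal (@riesz_amp_ge0) (@riesz_amp_l1)).
  by rewrite (inj_eq (@slot_inj j)).
have nw : sn riesz_form w ^+ 2 <= 4 * S.
  rewrite (sn_sqr_orthogonal hB _ (iota_uniq 0 _) ou).
  rewrite mulr_sumr; apply: ler_sum => k _.
  rewrite cabs_real real_normK ?num_real// mulrC ler_wpM2r ?sqr_ge0//.
  rewrite (_ : 4 = 2 ^+ 2); last by ring.
  rewrite ler_pXn2r ?nnegrE ?sn_ge0//.
  exact: sn_resid riesz_amp_ge0 riesz_amp_l1 _.
(* 'X * g is the weighted average; 1 - 'X * g = - w / S *)
pose g := \sum_(0 <= k < m) (riesz_amp (slot j k) / S)%:C *: 'X^((freq riesz_poly (slot j k)).-1).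
exists g.
have -> : 1 - 'X * g = (- S^-1%:C) *: w.
  have wE : w = S%:C *: ('X * g - 1).
    have SE : S%:C *: 1 = \sum_(0 <= k < m) (riesz_amp (slot j k) ^+ 2)%:C *: 1 :> {poly C}.
      by rewrite /S rmorph_sum scaler_suml.
    rewrite scalerBr mulr_sumr scaler_sumr SE -sumrB.
    apply: eq_bigr => k _; rewrite /u /resid riesz_poly_slot p1 scalerBr scalerA.
    have aS : S%:C * (riesz_amp (slot j k) / S)%:C = (riesz_amp (slot j k))%:C.
      by rewrite -rmorphM mulrCA mulfV ?mulr1// gt_eqF.
    by rewrite -scalerAr scalerA aS -exprS prednK /freq ?addn1// -rmorphM -expr2.
  by rewrite wE scalerA mulNr -rmorphM mulVf ?gt_eqF// scaleN1r opprB.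
rewrite (snZ hB) cabsN cabs_real gtr0_norm ?invr_gt0// mulrC ler_pdivrMr//.
rewrite -(@ler_pXn2r _ 2%N) ?nnegrE ?sn_ge0 ?mulr_ge0 ?(ltW e0) ?(ltW S0)//.
apply: le_trans nw _; move: hm; rewrite ltr_pdivrMr ?exprn_gt0// => hm.
by rewrite exprMn expr2 mulrA ler_wpM2r ?(ltW S0)// mulrC ltW.
Qed.

End Construction.

(** * The shift on the completion *)
Section Assembly.
Variables (R : realType) (H : completeNormedModType R[i]).
Variables (ip : {dot H for Num.conj}) (i : {linear {poly R[i]} -> H}).
Hypothesis hn : induces_norm ip.
Hypothesis ip_riesz : forall f g, ip (i f) (i g) = riesz_form f g.
Hypothesis i_dense : forall x (e : R), 0 < e -> exists f, sn ip (x - i f) <= e.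
Local Notation n := (sn ip).
Let hB := dot_psd ip.

Lemma sn_i f : n (i f) = sn (@riesz_form R) f.
Proof. by rewrite /sn ip_riesz. Qed.

Lemma qpoly_dense_hilbert x (e : R) : 0 < e -> exists s, n (x - i (qpoly R s)) <= e.
Proof.
move=> e0; have e2 : 0 < e / 2 by rewrite divr_gt0.
have [f hf] := i_dense x e2; have [s hs] := qpoly_dense f e2; exists s.
rewrite (le_trans (sn_triangle hB (i f) _ _))// (snBC hB (i _)) -raddfB sn_i.
by have := le_trans (sn_le_l1 _) hs; lra.
Qed.

Lemma hilbert_separable : separable H.
Proof.
exists (range (i \o qpoly R)).
  exact: (sub_countable (card_image_le _ _) (countableP _)).
move=> O [x Ox] oO.
have /(nbhs_snP hn)[e e0 he] : nbhs x O by exact: open_nbhs_nbhs.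
have [s hs] := qpoly_dense_hilbert x (divr_gt0 e0 (ltr0n _ 2)).
exists (i (qpoly R s)); split; last by exists s.
by apply: he; apply: le_lt_trans hs _; lra.
Qed.

Variable T : {linear H -> H}.
Hypothesis Ti : forall f, T (i f) = i ('X * f).
Hypothesis T_isom : forall x, n (T x) = n x.

Lemma iter_i m f : iter m T (i f) = i ('X^m * f).
Proof.
elim: m => [|m IH]; first by rewrite expr0 mul1r.
by rewrite iterS IH Ti exprS mulrA.
Qed.

(** This is [riesz_form_null] on polynomials; it passes to the completion since
    the powers of [T] are uniformly bounded. *)
Lemma shift_iter_weakly_null x y (e : R) : 0 < e ->
  exists N, forall m, (N <= m)%N -> cabs (ip (iter m T x) y) < e.
Proof.
move=> e0.
have d0 : 0 < e / (3 * (n y + 1)).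
  by rewrite divr_gt0// mulr_gt0// ltr_wpDl// sn_ge0.
have [f hf] := i_dense x d0.
have d1 : 0 < e / (3 * (n (i f) + 1)).
  by rewrite divr_gt0// mulr_gt0// ltr_wpDl// sn_ge0.
have [g hg] := i_dense y d1.
have [N hN] := riesz_form_null f g (divr_gt0 e0 (ltr0n _ 3)); exists N => m /hN.
rewrite -ip_riesz -iter_i => h3.
have iterB z z' : iter m T (z - z') = iter m T z - iter m T z'.
  by elim: m {h3} => //= m ->; rewrite raddfB.
have small (b c : R) : 0 <= c -> b <= e / (3 * (c + 1)) -> c * b <= e / 3.
  move=> c0; have c1 : 0 < c + 1 by rewrite ltr_wpDl.
  rewrite ler_pdivlMr ?mulr_gt0// ler_pdivlMr// => hb.
  have [b0|b0] := leP 0 b; first by have := mulr_ge0 b0 c0; lra.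
  have : c * b <= 0 by rewrite mulr_ge0_le0// ltW.
  lra.
have h1 : cabs (ip (iter m T (x - i f)) y) <= e / 3.
  rewrite (le_trans (psd_CS hB _ _))// (sn_iter T_isom) mulrC.
  exact: small (sn_ge0 _ _) hf.
have h2 : cabs (ip (iter m T (i f)) (y - i g)) <= e / 3.
  rewrite (le_trans (psd_CS hB _ _))// (sn_iter T_isom).
  exact: small (sn_ge0 _ _) hg.
have -> : ip (iter m T x) y = ip (iter m T (x - i f)) y +
    ip (iter m T (i f)) (y - i g) + ip (iter m T (i f)) (i g).
  by rewrite iterB (psdBl hB) (psdBr hB); ring.
have := cabsD (ip (iter m T (x - i f)) y + ip (iter m T (i f)) (y - i g))
   (ip (iter m T (i f)) (i g)).
have := cabsD (ip (iter m T (x - i f)) y) (ip (iter m T (i f)) (y - i g)).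
lra.
Qed.

(** Polynomials without constant term are in the range, and [1] is a limit of such
    polynomials. *)
Lemma shift_range_dense y (e : R) : 0 < e -> exists x, n (y - T x) <= e.
Proof.
move=> e0; have e2 : 0 < e / 2 by rewrite divr_gt0.
have [f hf] := i_dense y e2.
have c1 : 0 < cabs f`_0 + 1 by rewrite ltr_wpDl ?cabs_ge0.
have [g hg] := one_approx (divr_gt0 e2 c1).
pose q := f`_0 *: g + drop_poly 1 f.
exists (i q); rewrite (le_trans (sn_triangle hB (i f) _ _))// (snBC hB (T _)).
have fE : f = f`_0 *: 1 + 'X * drop_poly 1 f.
  rewrite -{1}(poly_take_drop 1 f) mulrC expr1; congr (_ + _).
  by rewrite /take_poly poly_def big_ord1 expr0.
have -> : i f - T (i q) = i (f`_0 *: (1 - 'X * g)).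
  rewrite Ti -raddfB; congr (i _); rewrite {1}fE /q mulrDr -scalerAr.
  by rewrite opprD addrACA subrr addr0 scalerBr.
rewrite sn_i (snZ (@riesz_form_psd R)).
have : cabs f`_0 * sn (@riesz_form R) (1 - 'X * g) <= e / 2.
  apply: (@le_trans _ _ ((cabs f`_0 + 1) * (e / 2 / (cabs f`_0 + 1)))).
    by rewrite ler_pM ?cabs_ge0 ?sn_ge0// lerDl.
  by rewrite mulrC divfK// gt_eqF.
lra.
Qed.

Lemma shift_weakly_supercyclic : weakly_supercyclic T.
Proof.
exists (i 1); apply: (weakly_dense_orbit hn) => y e e0.
have [s hs] := qpoly_dense_hilbert y e0.
have [j pj] : exists j, enum_qpoly R j = qpoly R s.
  by exists (pickle s); rewrite enum_qpolyK.
have pE k : riesz_poly R (slot j k) = qpoly R s by rewrite riesz_poly_slot.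
exists (i (qpoly R s)), (fun k => freq (riesz_poly R) (slot j k)),
  (fun k => riesz_amp R (slot j k)), (fun k => i (resid (riesz_poly R) (@riesz_amp R) (slot j k))).
split=> //.
- move=> k; rewrite iter_i mulr1 /resid pE raddfB/= linearZ/=.
  by rewrite addrC subrK.
- move=> k l kl; rewrite ip_riesz; apply: resid_orthogonal; last first.
  + by rewrite (inj_eq (@slot_inj j)).
  + exact: riesz_amp_l1.
  + exact: riesz_amp_ge0.
- by move=> k; rewrite sn_i; apply: sn_resid; [exact: riesz_amp_ge0|exact: riesz_amp_l1].
- exact: riesz_amp_unbounded.
Qed.

Lemma shift_not_weakly_sequentially_supercyclic :
  ~ weakly_sequentially_supercyclic T.
Proof.
move=> [x hx].
have i10 : i 1 != 0.
  rewrite -(sn_eq0 hn) sn_i /sn /riesz_form rlim11 ?sqrtr1 ?oner_eq0//.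
    exact: riesz_amp_ge0.
  exact: riesz_amp_l1.
have [y hy] := proj_orbit_neqT hn T_isom shift_iter_weakly_null x i10.
apply: hy; have : @seq_closure (weak_topology H) (proj_orbit T x) y by rewrite hx.
by apply; split=> //; exact: (proj_orbit_seq_closed hn T_isom shift_iter_weakly_null).
Qed.

End Assembly.

Theorem corollary1p3 (R : realType) :
  exists (H : completeNormedModType R[i]) (ip : {dot H for Num.conj})
         (T : {linear H -> H}),
    induces_norm ip /\ separable H /\ unitary ip T /\
    weakly_supercyclic T /\ ~ weakly_sequentially_supercyclic T.
Proof.
have [H [ip [i [hn ip_riesz dense]]]] := gns_hilbert (@riesz_form_psd R).
have i_dense x (e : R) : 0 < e -> exists f, sn ip (x - i f) <= e.
  by move=> /(dense x)[f]; rewrite (normr_sn hn) lecR; exists f.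
have tlin : linear ( *%R ('X : {poly R[i]})).
  by move=> a f g; rewrite mulrDr scalerAr.
pose t : {linear {poly R[i]} -> {poly R[i]}} :=
  HB.pack ( *%R ('X : {poly R[i]})) (GRing.isLinear.Build _ _ _ _ _ tlin).
have t_isom f : sn ip (i (t f)) = sn ip (i f).
  by rewrite /sn !ip_riesz /= riesz_form_shift.
have [T [Ti T_isom]] := isometry_extend hn i_dense t_isom.
exists H, ip, T; split; first exact: hn.
split; first exact: hilbert_separable hn ip_riesz i_dense.
split.
  apply: (isometry_unitary hn T_isom); apply: (isometry_onto hn T_isom).
  exact: shift_range_dense ip_riesz i_dense T Ti.
split; first exact: shift_weakly_supercyclic hn ip_riesz i_dense T Ti.
exact: shift_not_weakly_sequentially_supercyclic hn ip_riesz i_dense T Ti T_isom.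
Qed.
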